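(* Assume the setting of the SDR detector with $\mathbf{H}\in\mathbb{R}^{n\times m}$ having i.i.d. Gaussian entries of zero mean and fixed non-zero variance, $\mathbf{v}\sim\mathcal{N}(\mathbf{0},\rho^{-1}\mathbf{I}_n)$, $\mathbf{s}$ uniform on $\{\pm1\}^m$, all independent, but now with $r\triangleq m-n>0$. Then $$\limsup_{\rho\to\infty}\frac{\ln\Pr(\hat{\mathbf{s}}_{\mathrm{SDR}}\neq\mathbf{s})}{\ln\rho}\le -d,\qquad d=\frac12\left(m-\frac{r(r+3)}{2}\right).$$
   Context: Model: $\mathbf{y}=\mathbf{H}\mathbf{s}+\mathbf{v}$. Let $\mathbf{e}$ be the all-ones vector, $\mathbf{L}=\begin{bmatrix}\mathbf{H}^T\mathbf{H}&-\mathbf{H}^T\mathbf{y}\\-\mathbf{y}^T\mathbf{H}&\mathbf{y}^T\mathbf{y}\end{bmatrix}$, and let $\mathbf{X}^\star$ be an optimal point (chosen by any fixed rule) of $\min\mathrm{Tr}(\mathbf{L}\mathbf{X})$ s.t. $\mathrm{diag}(\mathbf{X})=\mathbf{e}$, $\mathbf{X}\succeq\mathbf{0}$, $\mathbf{X}\in\mathbb{S}^{m+1}$. The SDR estimate is $[\hat{\mathbf{s}}_{\mathrm{SDR}}]_i=\mathrm{sgn}([\mathbf{X}^\star]_{i,m+1})$, $i=1,\dots,m$, with $\mathrm{sgn}(x)=1$ if $x>0$ and $-1$ if $x\le0$. *)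

(* Defs.v *)
From HB Require Import structures.
From mathcomp Require Import all_boot all_order all_algebra.
From mathcomp Require Import all_classical all_reals all_analysis.
Set Implicit Arguments. Unset Strict Implicit. Unset Printing Implicit Defensive.
Import Order.TTheory GRing.Theory Num.Theory.
Import numFieldNormedType.Exports.
Local Open Scope classical_set_scope.
Local Open Scope ring_scope.

Section SDR.
Variable R : realType.

Definition sgn (x : R) : R := if 0 < x then 1 else -1.

Definition psd k (X : 'M[R]_k) : Prop := forall x : 'cV[R]_k, 0 <= (x^T *m X *m x) 0 0.

Definition sdr_feasible k (X : 'M[R]_k) : Prop :=
  X^T = X /\ (forall i, X i i = 1) /\ psd X.

Definition sdr_optimal k (L X : 'M[R]_k) : Prop :=
  sdr_feasible X /\ forall Y, sdr_feasible Y -> \tr (L *m X) <= \tr (L *m Y).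

Definition sdr_L n m (H : 'M[R]_(n, m)) (y : 'cV[R]_n) : 'M[R]_(m + 1) :=
  block_mx (H^T *m H) (- (H^T *m y)) (- (y^T *m H)) (y^T *m y).

(** SDR estimate, for a fixed selection rule [sel] of an optimal point:
    [s_SDR]_i = sgn([X*]_{i, m+1}) *)
Definition sdr_est n m (sel : 'M[R]_(m + 1) -> 'M[R]_(m + 1))
    (H : 'M[R]_(n, m)) (y : 'cV[R]_n) : 'cV[R]_m :=
  \col_i sgn (sel (sdr_L H y) (lshift 1 i) (rshift m ord0)).

Definition sdr_d (n m : nat) : R :=
  let r : R := (m - n)%N%:R in (m%:R - r * (r + 3) / 2) / 2.

Definition eln (x : \bar R) : \bar R :=
  if x == 0%E then -oo%E else (ln (fine x))%:E.
End SDR.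

(** index set of the scalar random variables: entries of H, of the
    standard noise w (v = rho^{-1/2} w), and of s *)
Definition sdr_index (n m : nat) : finType := (('I_n * 'I_m) + 'I_n + 'I_m)%type.

Section Prob.
Context {R : realType} {d : measure_display} {T : measurableType d}.
Variable P : probability T R.

Definition has_law (Y : T -> R) (mu : set R -> \bar R) : Prop :=
  forall A : set R, measurable A -> P (Y @^-1` A) = mu A.

Definition mutually_independent (I : finType) (X : I -> T -> R) : Prop :=
  forall A : I -> set R, (forall i, measurable (A i)) ->
    P [set w | forall i, A i (X i w)] = (\prod_(i : I) P (X i @^-1` A i))%E.

Variables (n m : nat) (X : sdr_index n m -> T -> R).
Definition rv_H (w : T) : 'M[R]_(n, m) := \matrix_(i, j) X (inl (inl (i, j))) w.
Definition rv_w (w : T) : 'cV[R]_n := \col_i X (inl (inr i)) w.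
Definition rv_s (w : T) : 'cV[R]_m := \col_j X (inr j) w.
Definition rv_v (rho : R) (w : T) : 'cV[R]_n := (Num.sqrt rho)^-1 *: rv_w w.

Definition sdr_error_event (sel : 'M[R]_(m + 1) -> 'M[R]_(m + 1)) (rho : R) : set T :=
  [set w | sdr_est sel (rv_H w) (rv_H w *m rv_s w + rv_v rho w) != rv_s w].
End Prob.

(* Main.v *)
(** By optimality and the parallelogram inequality, an error forces the Gram
    matrix [W] of the vectors [z_i = s_i x_i - x_{m+1}] (where the [x_i] realize
    the optimal [X]) to satisfy [h W h^T <= 4 |v|^2] for every row [h] of
    [H diag(s)].  The [z_i] lie on a sphere through the origin and, after
    rescaling, the longest of them has norm 1.  Take a pivoted Cholesky
    factorization of [W] with factor rows [z_0, z_1, ...] and pivots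
    [sigma_0 = 1, sigma_1, ...], and work at resolution [eps = rho^(-1/2)].  Up
    to negligible factors, the triangular system [|h . z_b| <= eps] has
    probability [prod_b (eps / sigma_b)^n], while the factor rows take
    [prod_{b >= 1} (sigma_b / eps)^(m - b + 1)] values: the sphere equation
    determines one coordinate of size of order 1 in each column other than the
    longest one.  The product is at most
    [eps^n prod_{b >= 1} (sigma_b / eps)^(r - b + 1) <= eps^(n - r (r + 1) / 2)],
    and [n - r (r + 1) / 2 = 2 d].

    The estimate only needs to hold up to factors [rho^o(1)], so everything is
    discretized with [eps = M^(-J)]: constants, logarithms and the range of the
    Gaussian variables are absorbed in powers of [M] whose exponent does not
    depend on [J], and [J] is sent to infinity at the end.  Discretizing [H] as
    well turns the probability into a count of integer matrices times the
    probability of one cell, so that no integration over [H] is needed. *)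

Require Import Defs.
From HB Require Import structures.
From mathcomp Require Import all_boot all_order all_algebra all_fingroup.
From mathcomp Require Import zify ring lra.
Set Implicit Arguments. Unset Strict Implicit. Unset Printing Implicit Defensive.
Import Order.TTheory GRing.Theory Num.Theory.
Local Open Scope ring_scope.

(** * Counting integer matrices *)
(** Coordinates are fixed one at a time, in order of increasing rank. Once those of smaller rank
    agree on [S], coordinate [k] takes at most [B k + 1] values, and [S] splits accordingly. The set
    [D] of the induction contains every coordinate not yet known to be constant on [S]. *)
Lemma card_windows (T I : finType) (S : {set T}) (x : I -> T -> int)
    (rk B : I -> nat) :
  (forall f g, f \in S -> g \in S -> (forall k, x k f = x k g) -> f = g) ->
  (forall k f g, f \in S -> g \in S ->
     (forall l, (rk l < rk k)%N -> x l f = x l g) -> x k f - x k g <= (B k)%:Z) ->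
  (#|S| <= \prod_k (B k).+1)%N.
Proof.
suff main : forall q (D : {set I}) (S : {set T}), #|D| = q ->
    (forall f g, f \in S -> g \in S -> (forall k, x k f = x k g) -> f = g) ->
    (forall k f g, f \in S -> g \in S ->
       (forall l, (rk l < rk k)%N -> x l f = x l g) ->
       x k f - x k g <= (B k)%:Z) ->
    (forall k f g, k \notin D -> f \in S -> g \in S -> x k f = x k g) ->
    (#|S| <= \prod_(k in D) (B k).+1)%N.
  move=> inj win; have := main _ [set: I] S erefl inj win.
  rewrite (eq_bigl _ _ (fun k => in_setT k)); apply => k f g.
  by rewrite in_setT.
elim=> [|q IHq] {}D {}S cD inj win agree.
  rewrite (cards0_eq cD) big_set0; apply/card_le1P => f fS g.
  rewrite inE; apply/idP/eqP => [gS|->//].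
  by apply: inj => // k; apply: agree; rewrite // (cards0_eq cD) inE.
have [k0 k0D] : exists k, k \in D by apply/set0Pn; rewrite -card_gt0 cD.
have [k kD0 kmin] := arg_minnP rk k0D; have {kD0} kD : k \in D by [].
have win_k f g : f \in S -> g \in S -> x k f - x k g <= (B k)%:Z.
  move=> fS gS; apply: win => // l; rewrite ltnNge => lk.
  by apply: agree => //; apply: contra lk => /kmin.
have [->|[f0 f0S]] := set_0Vmem S; first by rewrite cards0.
have [f1 f1S f1min] := @arg_minP _ _ T f0 (mem S) (x k) f0S.
pose Su (u : 'I_(B k).+1) := [set f in S | x k f == x k f1 + (u : nat)%:Z].
have SU : S \subset \bigcup_u Su u.
  apply/fintype.subsetP => f fS; have d := win_k f f1 fS f1S.
  have d0 : 0 <= x k f - x k f1 by rewrite subr_ge0 f1min.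
  have lt : (`|x k f - x k f1|%N < (B k).+1)%N by lia.
  apply/bigcupP; exists (Ordinal lt) => //; rewrite inE fS /=; lia.
apply: leq_trans (subset_leq_card SU) _.
apply: leq_trans (_ : \sum_u #|Su u| <= _)%N.
  elim/big_rec2: _ => [|u a A _ h]; first by rewrite cards0.
  apply: leq_trans (leq_card_setU _ _) _; exact: leq_add.
rewrite (big_setD1 k) //= -[in leqRHS](card_ord (B k).+1) -sum_nat_const.
apply: leq_sum => u _; apply: IHq.
- by move: cD; rewrite (cardsD1 k) kD => -[].
- by move=> f g /setIdP[fS _] /setIdP[gS _]; exact: inj.
- by move=> l f g /setIdP[fS _] /setIdP[gS _]; exact: win.
- move=> l f g; rewrite in_setD1 negb_and negbK => /orP[/eqP->|lD].
    by move=> /setIdP[_ /eqP->] /setIdP[_ /eqP->].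
  by move=> /setIdP[fS _] /setIdP[gS _]; exact: agree.
Qed.

(** Truncated subtraction kills the terms with [b > r], so the bound [r + ... + 1] does not depend
    on [N]. *)
Lemma sum_triangle (N r : nat) : (\sum_(1 <= b < N) (r.+1 - b) <= 'C(r.+1, 2))%N.
Proof.
elim: r N => [|r IHr] N.
  by rewrite big_nat big1 // => b; lia.
case: N => [|N]; first by rewrite big_geq.
case: N => [|N]; first by rewrite big_geq.
rewrite big_ltn // big_add1 /= subn1 /= binS bin1 addnC.
rewrite leq_add2r; apply: leq_trans (IHr N.+1).
by rewrite leq_eqVlt; apply/orP; left; apply/eqP/eq_bigr => b _; rewrite subSS.
Qed.

(** The three sums are the exponents of the windows for [c], [z] and [h]. In each column [p] the
    solved row [t p] saves about [J], and these savings cancel the contribution [(m + 1) J] of row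
    0. For [b >= 1] the coefficient of [j b] is [1 + (m + 1 - b) - n = r + 1 - b], so the worst case
    is [j b = J] when [b <= r] and [j b = 0] beyond. The last term collects the additive
    constants. *)
Lemma exponent_bound (n m r J : nat) (j : 'I_m.+1 -> nat)
    (t : 'I_m.+1 -> 'I_m.+1) :
  m.+1 = (n + r)%N -> (forall b, j b <= J)%N -> j ord0 = J ->
  (forall p, t p <= p)%N -> (forall p, J <= j (t p) + 2)%N ->
  (\sum_(b < m.+1) (if b == ord0 then 0 else j b + 1)
   + \sum_(b < m.+1) \sum_(p < m.+1) (if p < b then 0 else if b == t p then 4 else j b + 2)
   + \sum_(a < n) \sum_(p < m.+1) (J - j p + 3)
   <= n * m * J + 'C(r.+1, 2) * J + 9 * m.+1 * (m.+1 + n))%N.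
Proof.
move=> mnr jJ j0 tle tJ.
have zsum (p : 'I_m.+1) : (\sum_(b < m.+1)
    (if (p < b)%N then 0 else if b == t p then 4 else j b + 2) + J
    <= \sum_(b < m.+1) (if (p < b)%N then 0 else j b) + 4 * m.+1 + 2)%N.
  rewrite (bigD1 (t p)) //= [in leqRHS](bigD1 (t p)) //= ltnNge tle /= eqxx.
  have -> : (4 * m.+1 = 4 + \sum_(b < m.+1 | b != t p) 4)%N.
    by rewrite sum_nat_const cardC1 card_ord mulnC mulSn.
  have : (\sum_(b < m.+1 | b != t p)
      (if (p < b)%N then 0 else if b == t p then 4 else j b + 2)
    <= \sum_(b < m.+1 | b != t p) (if (p < b)%N then 0 else j b)
       + \sum_(b < m.+1 | b != t p) 4)%N.
    by rewrite -big_split; apply: leq_sum => b /negPf-> /=; case: ifP => _; lia.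
  move: (tJ p); move: (\sum_(_ < _ | _) _)%N => s1; move: (\sum_(_ < _ | _) _)%N => s2.
  move: (\sum_(_ < _ | _) _)%N (j (t p)) => s3 jt.
  lia.
rewrite exchange_big /=.
have zs : (\sum_(p < m.+1) \sum_(b < m.+1)
    (if (p < b)%N then 0 else if b == t p then 4 else j b + 2) + m.+1 * J
    <= \sum_(b < m.+1) (m.+1 - b) * j b + m.+1 * (4 * m.+1 + 2))%N.
  have -> : (\sum_(b < m.+1) (m.+1 - b) * j b =
      \sum_(p < m.+1) \sum_(b < m.+1) (if (p < b)%N then 0 else j b))%N.
    rewrite exchange_big; apply: eq_bigr => b _.
    rewrite (eq_bigr (fun p : 'I_m.+1 => if (b <= p)%N then j b else 0%N)).
      rewrite -big_mkcond sum_nat_const; congr (_ * _)%N.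
      by rewrite -sum1_card -(big_geq_mkord b _ xpredT (fun=> 1%N))
        sum_nat_const_nat muln1.
    by move=> p _; rewrite ltnNge; case: (b <= p)%N.
  have -> : (m.+1 * J = \sum_(p < m.+1) J)%N by rewrite sum_nat_const card_ord.
  have -> : (m.+1 * (4 * m.+1 + 2) = \sum_(p < m.+1) (4 * m.+1 + 2))%N.
    by rewrite sum_nat_const card_ord.
  by rewrite -!big_split; apply: leq_sum => p _; have := zsum p; rewrite -addnA.
have -> : (\sum_(a < n) \sum_(p < m.+1) (J - j p + 3) =
    n * \sum_(p < m.+1) (J - j p) + n * (m.+1 * 3))%N.
  by rewrite sum_nat_const card_ord big_split sum_nat_const card_ord -mulnDr.
have tot : (\sum_(b < m.+1) (if b == ord0 then 0 else j b + 1)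
    + \sum_(b < m.+1) (m.+1 - b) * j b + n * \sum_(p < m.+1) (J - j p)
    <= m.+1 * J + \sum_(1 <= b < m.+1) (r.+1 - b) * J + m * (n * J + 1))%N.
  rewrite !big_ord_recl /= j0 subnn subn0 add0n add0n big_add1 /= big_mkord.
  have -> : (m * (n * J + 1) = \sum_(b < m) (n * J + 1))%N.
    by rewrite sum_nat_const card_ord.
  suff : (\sum_(b < m) (j (lift ord0 b) + 1)
    + \sum_(b < m) (m.+1 - bump 0 b) * j (lift ord0 b)
    + n * \sum_(b < m) (J - j (lift ord0 b)) <=
    \sum_(b < m) (r.+1 - b.+1) * J + \sum_(b < m) (n * J + 1))%N.
    by do 5 move: (\sum_(_ < _) _)%N => ?; lia.
  rewrite big_distrr -!big_split; apply: leq_sum => b _ /=.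
  have := jJ (lift ord0 b); have := ltn_ord b.
  rewrite /bump /= add1n; move: (j _) => x bm xJ.
  have -> : (n * J = n * (J - x) + n * x)%N by rewrite -mulnDr subnK.
  have [br|br] := leqP b r.
    have : ((r - b) * x <= (r - b) * J)%N by rewrite leq_mul.
    have -> : ((m.+1 - b.+1) * x = (m - b) * x)%N by rewrite subSS.
    have : (x + (m - b) * x = (r - b) * x + n * x)%N.
      by rewrite -mulnDl -mulSn; congr (_ * _)%N; lia.
    by rewrite subSS; lia.
  have : (x + (m.+1 - b.+1) * x <= n * x)%N by rewrite -mulSn leq_mul //; lia.
  lia.
have tri : (\sum_(1 <= b < m.+1) (r.+1 - b) * J <= 'C(r.+1, 2) * J)%N.
  by rewrite -big_distrl leq_mul2r sum_triangle orbT.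
move: tot zs tri; do ![move: (\sum_(_ <- _ | _) _)%N => ?].
nia.
Qed.

Lemma floor_window (R : archiRealFieldType) (x y : R) (B : nat) :
  x - y <= B%:R -> Num.floor x - Num.floor y <= B%:Z.
Proof.
move=> xyB; rewrite -ltzD1 -(ltr_int R) !intrD mulrNz.
have := floor_le x; have := floorD1_gt y.
rewrite intrD -[1%:~R]/(1 : R) -[(B%:Z)%:~R]/(B%:R : R); lra.
Qed.

Lemma floor_eq_dist (R : archiRealFieldType) (x y : R) :
  Num.floor x = Num.floor y -> `|x - y| <= 1.
Proof.
move=> xy; have := floor_le x; have := floorD1_gt x.
have := floor_le y; have := floorD1_gt y.
rewrite xy intrD -[1%:~R]/(1 : R) => *.
by rewrite ler_norml; apply/andP; split; lra.
Qed.

(* The rows of [z], read through the column permutation [pi], form a pivoted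
   Cholesky factor whose [b]-th pivot has size about [M ^ (j b) / M ^ J]; the
   columns of [z] lie on the sphere [|x|^2 = c . x].  In column [p] the
   coordinate [t p] is the one recovered from the others by solving the sphere
   equation, [sg p] selecting the root. *)
Record near_degenerate (R : archiRealFieldType) (n m M J : nat)
    (pi : {perm 'I_m.+1}) (j : 'I_m.+1 -> nat) (t : 'I_m.+1 -> 'I_m.+1)
    (sg : 'I_m.+1 -> bool) (h : 'M[R]_(n, m.+1)) (z : 'M[R]_m.+1)
    (c : 'I_m.+1 -> R) : Prop := NearDegenerate {
  nd_upper : forall b p : 'I_m.+1, (p < b)%N -> z b p = 0;
  nd_pivot : forall b p, `|z b p| <= z b b;
  nd_le1 : forall b, z b b <= 1;
  nd_lo : forall b, j b = 0%N \/ M%:R ^+ j b <= z b b * M%:R ^+ J;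
  nd_hi : forall b, z b b * M%:R ^+ J <= M%:R ^+ (j b).+1;
  nd_c0 : c ord0 = 1;
  nd_c : forall b, `|c b| <= 2;
  nd_sphere : forall p, \sum_b z b p ^+ 2 = \sum_b c b * z b p;
  nd_level : forall p, (J <= j (t p) + 2)%N;
  nd_solve : forall p,
    M%:R^-1 <= (-1) ^+ sg p * (z (t p) p - c (t p) / 2);
  nd_small : forall a b, `|\sum_p h a (pi p) * z b p| * M%:R ^+ J <= M%:R ^+ 2;
  nd_bound : forall a i, `|h a i| <= M%:R }.

(** The condition [t p <= p] keeps the solved coordinate inside the triangular support of column
    [p]. *)
Definition degenerate (R : archiRealFieldType) (n m M J : nat)
    (h : 'M[R]_(n, m.+1)) : Prop :=
  exists (pi : {perm 'I_m.+1}) (j : 'I_m.+1 -> nat) (t : 'I_m.+1 -> 'I_m.+1)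
      (sg : 'I_m.+1 -> bool) z c,
    [/\ forall b, (j b <= J)%N, j ord0 = J, forall p, (t p <= p)%N &
        near_degenerate M J pi j t sg h z c].

(** * Windows for two near-degenerate configurations with the same discrete data *)

Section Windows.
Variables (R : archiRealFieldType) (n m M J : nat).
Variables (pi : {perm 'I_m.+1}) (j : 'I_m.+1 -> nat) (t : 'I_m.+1 -> 'I_m.+1).
Variables (sg : 'I_m.+1 -> bool).
Variables (h h' : 'M[R]_(n, m.+1)) (z z' : 'M[R]_m.+1) (c c' : 'I_m.+1 -> R).
Hypothesis mM : (m + 10 <= M)%N.
Hypothesis nd : near_degenerate M J pi j t sg h z c.
Hypothesis nd' : near_degenerate M J pi j t sg h' z' c'.
Let N : R := M%:R ^+ J.

Let M_ge10 : 10 <= M%:R :> R.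
Proof. by rewrite (ler_nat R 10); lia. Qed.

Let m_le : m%:R + 10 <= M%:R :> R.
Proof. by rewrite -(natrD R m 10) ler_nat. Qed.

Let N_gt0 : 0 < N.
Proof. by rewrite exprn_gt0 //; move: M_ge10; lra. Qed.

Let Mk_ge1 k : 1 <= M%:R ^+ k :> R.
Proof. by rewrite exprn_ege1 //; move: M_ge10; lra. Qed.

(** The coefficient [c b] is only resolved to [M ^- j b]: it multiplies entries of row [b], of size
    at most [M ^ (j b + 1) / N], so the error in the product is still of order [M / N]. *)
Lemma coef_window b :
  c b * M%:R ^+ j b - c' b * M%:R ^+ j b <= M%:R ^+ (j b + 1) - 1.
Proof.
have := nd_c nd b; have := nd_c nd' b; rewrite !ler_norml addn1 exprS.
move=> /andP[? ?] /andP[? ?]; have := Mk_ge1 (j b); move: (_ ^+ _) => y y1.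
have : 0 <= (4 - (c b - c' b)) * y by apply: mulr_ge0; lra.
have : 0 <= (M%:R - 10) * y by apply: mulr_ge0; move: M_ge10; lra.
lra.
Qed.

(** Pivoting bounds all of row [b] by its pivot, hence by [M ^ (j b + 1) / N]. *)
Lemma free_window b p : z b p * N - z' b p * N <= M%:R ^+ (j b + 2) - 1.
Proof.
have := nd_pivot nd b p; have := nd_pivot nd' b p; rewrite !ler_norml.
move=> /andP[? ?] /andP[? ?]; have := nd_hi nd b; have := nd_hi nd' b.
rewrite addn2 -/N [X in _ -> _ -> _ <= X - 1]exprS; have := Mk_ge1 (j b).+1; move: (_ ^+ _) => y y1 *.
have : 0 <= (z b b - z b p) * N by apply: mulr_ge0; [lra|exact: ltW].
have : 0 <= (z' b p + z' b b) * N by apply: mulr_ge0; [lra|exact: ltW].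
have : 0 <= (M%:R - 10) * y by apply: mulr_ge0; move: M_ge10; lra.
lra.
Qed.

Hypothesis close_c : forall b, `|c b - c' b| * M%:R ^+ j b <= 1.

(** Completing the square in row [t p] expresses [d ^ 2] through the other coordinates, so
    [d ^ 2 - d' ^ 2] is of order [M ^ 2 / N]. Both [d] and [d'] have the sign given by [sg p] and
    modulus at least [1 / M]; dividing by [d + d'] therefore costs only one more factor [M]. *)
Lemma solved_window p :
  (forall b, b != t p -> `|z b p - z' b p| * N <= 1) ->
  z (t p) p * N - z' (t p) p * N <= M%:R ^+ 4 - 1.
Proof.
move=> close_z.
set d := z (t p) p - c (t p) / 2; set d' := z' (t p) p - c' (t p) / 2.
have sq : d ^+ 2 - d' ^+ 2 = (c (t p) ^+ 2 - c' (t p) ^+ 2) / 4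
    - \sum_(b | b != t p)
        ((z b p ^+ 2 - c b * z b p) - (z' b p ^+ 2 - c' b * z' b p)).
  have s1 := nd_sphere nd p; have s2 := nd_sphere nd' p.
  move: s1 s2; rewrite (bigD1 (t p)) //= [X in _ = X](bigD1 (t p)) //=.
  rewrite (bigD1 (t p) (F := fun b => z' b p ^+ 2)) //=.
  rewrite [X in _ -> _ = X -> _](bigD1 (t p)) //=.
  rewrite !sumrB /d /d'; do 4 move: (\sum_(_ | _) _) => ?; lra.
(* Row [t p] has level at least [J - 2], so its coefficient is known almost to resolution
   [1 / N]. *)
have ct : `|c (t p) - c' (t p)| * N <= M%:R ^+ 2.
  have lev : N <= M%:R ^+ (j (t p) + 2).
    by rewrite ler_weXn2l ?(nd_level nd) //; move: M_ge10; lra.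
  apply: le_trans (ler_wpM2l (normr_ge0 _) lev) _.
  rewrite exprD mulrA -[leRHS]mul1r; apply: ler_wpM2r (close_c _).
  by rewrite exprn_ge0.
(* The change of [z] has a factor at most 4 and contributes 4; the change of [c], at most
   [M ^- j b], meets an entry of size at most [M ^ (j b + 1) / N] and contributes [M]. *)
have term b : b != t p ->
    `|(z b p ^+ 2 - c b * z b p) - (z' b p ^+ 2 - c' b * z' b p)| * N
      <= M%:R + 4.
  move=> /close_z zb; have cb := close_c b.
  have -> : (z b p ^+ 2 - c b * z b p) - (z' b p ^+ 2 - c' b * z' b p) =
      (z b p - z' b p) * (z b p + z' b p - c b) - (c b - c' b) * z' b p by ring.
  apply: le_trans (ler_wpM2r (ltW N_gt0) (ler_normB _ _)) _.
  rewrite !normrM mulrDl addrC; apply: lerD.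
    have zM : `|z' b p| * N <= M%:R * M%:R ^+ j b.
      rewrite -exprS; apply: le_trans (nd_hi nd' b).
      rewrite -/N; exact: (ler_wpM2r (ltW N_gt0) (nd_pivot nd' b p)).
    rewrite -mulrA; apply: le_trans (ler_wpM2l (normr_ge0 _) zM) _.
    rewrite mulrCA -[leRHS]mulr1; exact: ler_wpM2l.
  rewrite mulrAC -[leRHS]mul1r; apply: ler_pM => //.
    by rewrite mulr_ge0 // ltW.
  have := nd_pivot nd b p; have := nd_pivot nd' b p; have := nd_c nd b.
  have := nd_le1 nd b; have := nd_le1 nd' b.
  have := ler_normB (z b p + z' b p) (c b).
  have := ler_normD (z b p) (z' b p); lra.
have dN : `|d ^+ 2 - d' ^+ 2| * N <= 3 * M%:R ^+ 2.
  rewrite sq; apply: le_trans (ler_wpM2r (ltW N_gt0) (ler_normB _ _)) _.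
  rewrite mulrDl; have -> : 3 * M%:R ^+ 2 = M%:R ^+ 2 + 2 * M%:R ^+ 2 :> R by ring.
  apply: lerD.
    rewrite subr_sqr mulrAC !normrM mulrAC [X in X * _]mulrAC.
    apply: le_trans ct.
    rewrite -[leRHS]mulr1 -mulrA; apply: ler_wpM2l.
      by rewrite mulr_ge0 // ltW.
    have := ler_normD (c (t p)) (c' (t p)); have := nd_c nd (t p).
    have := nd_c nd' (t p); rewrite (@ger0_norm _ 4^-1) ?invr_ge0 //; lra.
  apply: le_trans (ler_wpM2r (ltW N_gt0) (ler_norm_sum _ _ _)) _.
  rewrite mulr_suml; apply: le_trans (ler_sum _ term) _.
  rewrite sumr_const cardC1 card_ord /= -mulr_natl.
  by move: m_le M_ge10 (ler0n R m); nra.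
have dd : `|d - d'| * N <= 3 * M%:R ^+ 3 / 2.
  have dpos := nd_solve nd p; have dpos' := nd_solve nd' p.
  rewrite -/d in dpos; rewrite -/d' in dpos'.
  have M0 : 0 < M%:R :> R by move: M_ge10; lra.
  have : 2 / M%:R <= `|d + d'|.
    apply: le_trans (_ : `|(-1) ^+ sg p * (d + d')| <= _).
      by apply: le_trans (ler_norm _); rewrite mulrDr; lra.
    by rewrite normrM normr_sign mul1r.
  move=> sum_ge; rewrite subr_sqr normrM in dN.
  have : `|d - d'| * N * (2 / M%:R) <= 3 * M%:R ^+ 2.
    apply: le_trans dN; rewrite mulrAC; apply: (ler_wpM2r (ltW N_gt0)).
    exact: ler_wpM2l.
  rewrite mulrA ler_pdivrMr //; move: (_ * N) => u hu.
  by rewrite ler_pdivlMr // (le_trans hu) // [X in _ <= _ * X]exprS; nra.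
have := ler_norm (z (t p) p - z' (t p) p).
have : z (t p) p - z' (t p) p = (d - d') + (c (t p) - c' (t p)) / 2.
  by rewrite /d /d'; field.
have := ler_norm (d - d'); have := ler_norm (c (t p) - c' (t p)).
move=> n1 n2 eqz _; rewrite -mulrBl eqz.
have n1N := ler_wpM2r (ltW N_gt0) n1; have n2N := ler_wpM2r (ltW N_gt0) n2.
have : (d - d' + (c (t p) - c' (t p)) / 2) * N <= 3 * M%:R ^+ 3 / 2 + M%:R ^+ 2 / 2.
  by rewrite mulrDl mulrAC; lra.
move/le_trans; apply; rewrite [X in _ <= X - 1]exprS.
have -> : M%:R ^+ 3 = M%:R * M%:R ^+ 2 :> R by rewrite exprS.
have := Mk_ge1 2; move: (_ ^+ 2) => y y1.
have y10 : 0 <= (M%:R - 10) * y by apply: mulr_ge0; move: M_ge10; lra.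
have : 0 <= (M%:R - 10) * (M%:R * y) by apply: mulr_ge0; move: M_ge10; lra.
lra.
Qed.

(** Back substitution in the triangular system. Row [p] of [z] vanishes before column [p] and the
    entries of [h] in later columns are already known, so the small inner product with this row
    determines [h a (pi p)] up to order [M ^ 2 / N] divided by the pivot. *)
Lemma entry_window a (p : 'I_m.+1) :
  (forall b q, `|z b q - z' b q| * N <= 1) ->
  (forall q : 'I_m.+1, (p < q)%N -> `|h a (pi q) - h' a (pi q)| * N <= 1) ->
  h a (pi p) * N - h' a (pi p) * N <= M%:R ^+ (J - j p + 3) - 1.
Proof.
move=> close_z close_h.
have key : `|h a (pi p) - h' a (pi p)| * z p p * N <= 4 * M%:R ^+ 2.
  have zpp : 0 <= z p p by apply: le_trans (nd_pivot nd p p).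
  have -> : `|h a (pi p) - h' a (pi p)| * z p p =
      `|(\sum_q h a (pi q) * z p q) - (\sum_q h' a (pi q) * z' p q)
        - \sum_q h' a (pi q) * (z p q - z' p q)
        - \sum_(q < m.+1 | q != p) (h a (pi q) - h' a (pi q)) * z p q|.
    rewrite -[X in _ * X](ger0_norm zpp) -normrM; congr (`|_|).
    rewrite -!sumrB [in RHS](bigD1 p) //= -addrA -sumrB.
    rewrite big1 ?addr0 => [|q _]; ring.
  apply: le_trans (ler_wpM2r (ltW N_gt0) (ler_normB _ _)) _.
  have tail : `|\sum_(q < m.+1 | q != p) (h a (pi q) - h' a (pi q)) * z p q| * N
      <= m%:R.
    apply: le_trans (ler_wpM2r (ltW N_gt0) (ler_norm_sum _ _ _)) _.
    rewrite mulr_suml; apply: le_trans (_ : \sum_(q < m.+1 | q != p) 1 <= _).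
      apply: ler_sum => q qp; have [qltp|] := ltnP q p.
        by rewrite (nd_upper nd) // mulr0 normr0 mul0r.
      rewrite leq_eqVlt eq_sym (negPf (qp : (q : nat) != p)) /= => /close_h hq.
      rewrite normrM mulrAC -[leRHS]mulr1; apply: ler_pM => //.
        by rewrite mulr_ge0 // ltW.
      exact: le_trans (nd_pivot nd p q) (nd_le1 nd p).
    by rewrite sumr_const cardC1 card_ord /=.
  have mid : `|\sum_q h' a (pi q) * (z p q - z' p q)| * N <= m.+1%:R * M%:R.
    apply: le_trans (ler_wpM2r (ltW N_gt0) (ler_norm_sum _ _ _)) _.
    rewrite mulr_suml; apply: le_trans (_ : \sum_(q < m.+1) M%:R <= _).
      apply: ler_sum => q _; rewrite normrM -mulrA -[leRHS]mulr1.
      apply: ler_pM => //; last exact: nd_bound nd' _ _.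
      by rewrite mulr_ge0 // ltW.
    by rewrite sumr_const card_ord mulr_natl.
  have s1 := nd_small nd a p; have s2 := nd_small nd' a p.
  rewrite -/N in s1 s2; rewrite mulrDl.
  have B1 := ler_wpM2r (ltW N_gt0) (ler_normB
    (\sum_q h a (pi q) * z p q - \sum_q h' a (pi q) * z' p q)
    (\sum_q h' a (pi q) * (z p q - z' p q))).
  have B2 := ler_wpM2r (ltW N_gt0) (ler_normB
    (\sum_q h a (pi q) * z p q) (\sum_q h' a (pi q) * z' p q)).
  rewrite !mulrDl in B1 B2.
  have : m%:R + m.+1%:R * M%:R <= 2 * M%:R ^+ 2 :> R.
    by rewrite -natr1; move: m_le M_ge10 (ler0n R m); nra.
  lra.
have := ler_norm (h a (pi p) - h' a (pi p)); rewrite -mulrBl => n1.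
apply: le_trans (ler_wpM2r (ltW N_gt0) n1) _.
have jJ : (j p <= J)%N \/ (J < j p)%N by case: leqP; [left|right].
(* A pivot of level 0 has no lower bound; there the range [M] of the entries is enough. *)
have [j0|zlo] := nd_lo nd p.
  rewrite j0 subn0 addn3 !exprS -/N.
  have := ler_normB (h a (pi p)) (h' a (pi p)).
  have := nd_bound nd a (pi p); have := nd_bound nd' a (pi p) => b1 b2 b3.
  have : `|h a (pi p) - h' a (pi p)| * N <= 2 * M%:R * N.
    by apply: ler_wpM2r; [exact: ltW|lra].
  have N1 : 1 <= N by exact: Mk_ge1.
  have MN : 0 <= (M%:R - 10) * N by apply: mulr_ge0; move: M_ge10; lra.
  have MMN : 0 <= (M%:R - 10) * (M%:R * N) by apply: mulr_ge0; move: M_ge10; lra.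
  have : 0 <= (M%:R - 10) * (M%:R * (M%:R * N)).
    by apply: mulr_ge0; move: M_ge10; lra.
  lra.
have hN : `|h a (pi p) - h' a (pi p)| * M%:R ^+ j p <= 4 * M%:R ^+ 2.
  by apply: le_trans key; rewrite -mulrA; exact: ler_wpM2l.
have : `|h a (pi p) - h' a (pi p)| * N <= 4 * M%:R ^+ 2 * M%:R ^+ (J - j p).
  (* Stated as an inequality because [J - j p] is truncated. *)
  have Ndecomp : N <= M%:R ^+ j p * M%:R ^+ (J - j p).
    by rewrite -exprD ler_weXn2l //; [move: M_ge10; lra|lia].
  apply: le_trans (ler_wpM2l (normr_ge0 _) Ndecomp) _.
  by rewrite mulrA; apply: ler_wpM2r => //; rewrite exprn_ge0.
move/le_trans; apply; rewrite exprD; have := Mk_ge1 (J - j p).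
move: (_ ^+ (J - _)) => y y1; rewrite [X in _ <= y * X - 1]exprS.
have : 1 <= M%:R ^+ 2 :> R by exact: Mk_ge1.
move: (_ ^+ 2) => x x1; have yx : 1 <= y * x by nra.
have : 0 <= (M%:R - 10) * (y * x) by apply: mulr_ge0; move: M_ge10; lra.
lra.
Qed.

End Windows.

(** The integer matrix alone identifies an element of [S]. The rounded [c] and [z] are added as
    auxiliary coordinates, since the windows for the matrix entries are narrow only once these are
    fixed. *)
Lemma card_near_degenerate (R : archiRealFieldType) (n m r M J : nat)
    (pi : {perm 'I_m.+1}) (j : 'I_m.+1 -> nat) (t : 'I_m.+1 -> 'I_m.+1)
    (sg : 'I_m.+1 -> bool) (T : finType) (S : {set T})
    (G : T -> 'M[int]_(n, m.+1)) :
  (m + 10 <= M)%N -> m.+1 = (n + r)%N -> injective G ->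
  (forall b, j b <= J)%N -> j ord0 = J -> (forall p, t p <= p)%N ->
  (forall f, f \in S -> exists h z c,
     near_degenerate (R := R) M J pi j t sg h z c
     /\ forall a i, G f a i = Num.floor (h a i * M%:R ^+ J)) ->
  (#|S| <= M ^ (n * m * J + 'C(r.+1, 2) * J + 9 * m.+1 * (m.+1 + n)))%N.
Proof.
move=> mM mnr Ginj jJ j0 tle SG.
have [->|[f0 f0S]] := set_0Vmem S; first by rewrite cards0.
have [w wP] : exists w : T -> 'M[R]_(n, m.+1) * 'M[R]_m.+1 * ('I_m.+1 -> R),
    forall f, f \in S -> near_degenerate M J pi j t sg (w f).1.1 (w f).1.2 (w f).2
      /\ forall a i, G f a i = Num.floor ((w f).1.1 a i * M%:R ^+ J).
  apply: (fin_all_exists (P := fun f v => f \in S ->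
    near_degenerate M J pi j t sg v.1.1 v.1.2 v.2
      /\ forall a i, G f a i = Num.floor (v.1.1 a i * M%:R ^+ J))) => f.
  have [fS|fS] := boolP (f \in S); last by exists (0, 0, fun=> 0).
  by have [h [z [c ?]]] := SG f fS; exists (h, z, c).
have nd f fS := (wP f fS).1; have GE f fS := (wP f fS).2.
have M0 : (0 < M)%N by lia.
(* The windows are applied to a fixed witness [(z, c)] of each matrix: first [c]
   and the free entries of [z], then the entries solved from the sphere equation,
   then the entries of the matrix itself from the last column to the first. *)
pose I : finType := ('I_m.+1 + 'I_m.+1 * 'I_m.+1 + 'I_n * 'I_m.+1)%type.
pose x (k : I) (f : T) : int := match k with
  | inl (inl b) => Num.floor ((w f).2 b * M%:R ^+ j b)
  | inl (inr (b, p)) => Num.floor ((w f).1.2 b p * M%:R ^+ J)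
  | inr (a, p) => G f a (pi p) end.
pose rk (k : I) := match k with
  | inl (inl b) => 0%N
  | inl (inr (b, p)) => nat_of_bool (b == t p)
  | inr (a, p) => (2 + (m - p))%N end.
pose e (k : I) := match k with
  | inl (inl b) => if b == ord0 then 0%N else (j b + 1)%N
  | inl (inr (b, p)) => if (p < b)%N then 0%N
                        else if b == t p then 4 else (j b + 2)%N
  | inr (a, p) => (J - j p + 3)%N end.
(* The level condition concerns the discrete data only, so one element of [S] supplies it. *)
have tJ p : (J <= j (t p) + 2)%N by exact: nd_level (nd f0 f0S) p.
(* A window of width [M ^ e k - 1] contains exactly [M ^ e k] integers; hence the [- 1] in the
   window bounds. The exponent is 0 for the constants [c ord0 = 1] and the zeros below the
   diagonal. *)
apply: (@leq_trans (\prod_k (M ^ e k).-1.+1)).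
  apply: (card_windows (x := x) (rk := rk)).
    move=> f g fS gS xfg; apply: Ginj; apply/matrixP => a i.
    by have := xfg (inr (a, pi^-1%g i)); rewrite /x permKV.
  move=> k f g fS gS agree.
  have predM q : (M ^ q).-1%:R = M%:R ^+ q - 1 :> R.
    by rewrite -subn1 natrB ?expn_gt0 ?M0 // natrX.
  have close_c : (0 < rk k)%N ->
      forall b, `|(w f).2 b - (w g).2 b| * M%:R ^+ j b <= 1.
    move=> rk0 b; have := agree (inl (inl b)) rk0; rewrite /x => /floor_eq_dist.
    by rewrite -mulrBl normrM [X in _ * X]ger0_norm // exprn_ge0.
  have close_z b p : (rk (inl (inr (b, p))) < rk k)%N ->
      `|(w f).1.2 b p - (w g).1.2 b p| * M%:R ^+ J <= 1.
    move=> rkb; have := agree (inl (inr (b, p))) rkb; rewrite /x => /floor_eq_dist.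
    by rewrite -mulrBl normrM [X in _ * X]ger0_norm // exprn_ge0.
  case: k agree close_c close_z => [[b|[b p]]|[a p]] agree close_c close_z.
  - rewrite /x /e; have [->|_] := eqVneq b ord0.
      by rewrite (nd_c0 (nd f fS)) (nd_c0 (nd g gS)) subrr.
    by apply: floor_window; rewrite predM; apply: coef_window mM (nd f fS) (nd g gS) b.
  - rewrite /x /e; have [pb|_] := ltnP p b.
      by rewrite !(nd_upper (nd _ _)) // subrr.
    case: eqP => [bt|_]; apply: floor_window; rewrite predM.
      rewrite bt; apply: (solved_window mM (nd f fS) (nd g gS)) => [|b' b't].
        by apply: close_c; rewrite /rk bt eqxx.
      by apply: close_z; rewrite /rk bt eqxx (negPf b't).
    exact: free_window mM (nd f fS) (nd g gS) b p.
  - rewrite /x /e !GE //; apply: floor_window; rewrite predM.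
    apply: (entry_window mM (nd f fS) (nd g gS)) => [b q|q pq].
      by apply: close_z; rewrite /rk; case: (_ == _).
    have rkq : (rk (inr (a, q)) < rk (inr (a, p)))%N.
      by rewrite /rk; have := ltn_ord q; lia.
    have := agree (inr (a, q)) rkq; rewrite /x !GE // => /floor_eq_dist.
    by rewrite -mulrBl normrM [X in _ * X]ger0_norm // exprn_ge0.
rewrite (eq_bigr (fun k => M ^ e k)%N) => [|k _]; last first.
  by rewrite prednK // expn_gt0 M0.
rewrite -expn_sum leq_pexp2l //.
apply: leq_trans (exponent_bound mnr jJ j0 tle tJ).
rewrite !big_sumType /= !pair_bigA /=.
by rewrite leq_add ?leq_add2l // eq_leq //; apply: eq_bigr => -[].
Qed.

From mathcomp Require Import all_classical all_reals all_analysis measurable_realfun.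
Import numFieldNormedType.Exports.
Local Open Scope classical_set_scope.
Local Open Scope ring_scope.

(** * From detection errors to near-degenerate matrices *)

Section Cholesky.
Variable R : realType.

Definition mxform k (A : 'M[R]_k) (x y : 'cV[R]_k) : R := (x^T *m A *m y) 0 0.

Lemma mxformE k (A : 'M[R]_k) x y :
  mxform A x y = \sum_i \sum_l x i 0 * A i l * y l 0.
Proof.
rewrite /mxform -mulmxA mxE; apply: eq_bigr => i _.
rewrite !mxE mulr_sumr; apply: eq_bigr => l _; by rewrite mulrA.
Qed.

Lemma mxform_delta k (A : 'M[R]_k) i l :
  mxform A (delta_mx i 0) (delta_mx l 0) = A i l.
Proof. by rewrite /mxform trmx_delta -rowE -colE !mxE. Qed.

Lemma mxformC k (A : 'M[R]_k) x y : A^T = A -> mxform A x y = mxform A y x.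
Proof.
move=> symA; rewrite !mxformE exchange_big; apply: eq_bigr => i _.
by apply: eq_bigr => l _; rewrite -[in LHS]symA mxE; ring.
Qed.

Lemma mxformDZ k (A : 'M[R]_k) x y a : A^T = A ->
  mxform A (x + a *: y) (x + a *: y)
  = mxform A x x + 2 * a * mxform A x y + a ^+ 2 * mxform A y y.
Proof.
move=> symA; have := mxformC x y symA; rewrite /mxform.
have -> : (x + a *: y)^T = x^T + a *: y^T by rewrite linearD linearZ.
rewrite !(mulmxDl, mulmxDr) -!(scalemxAl, scalemxAr) !mxE => ->; ring.
Qed.

Lemma mxform_CauchySchwarz k (A : 'M[R]_k) x y : A^T = A -> psd A ->
  mxform A x y ^+ 2 <= mxform A x x * mxform A y y.
Proof.
move=> symA pA; have pos a := pA (x + a *: y).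
have pos' a : 0 <= mxform A x x + 2 * a * mxform A x y + a ^+ 2 * mxform A y y.
  by rewrite -mxformDZ //; exact: pos.
have y0 : 0 <= mxform A y y by exact: pA.
move: (mxform A x x) (mxform A x y) (mxform A y y) pos' y0 => a b c pos' c0.
have [c_eq0|cn0] := eqVneq c 0.
  have [->|bn0] := eqVneq b 0; first by rewrite expr0n c_eq0 mulr0.
  (* With [c = 0] the form is affine in the scalar, and this choice gives it the value [-1]. *)
  have := pos' (- (a + 1) / (2 * b)); rewrite c_eq0 mulr0 addr0.
  have -> : 2 * (- (a + 1) / (2 * b)) * b = - (a + 1) by field.
  lra.
have c_gt0 : 0 < c by rewrite lt_def cn0.
have := pos' (- b / c).
have -> : a + 2 * (- b / c) * b + (- b / c) ^+ 2 * c = (a * c - b ^+ 2) / c.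
  by field.
by rewrite pmulr_lge0 ?invr_gt0 // subr_ge0.
Qed.

Lemma psd_entry k (A : 'M[R]_k) i l : A^T = A -> psd A ->
  A i l ^+ 2 <= A i i * A l l.
Proof. by move=> sA pA; rewrite -!mxform_delta; exact: mxform_CauchySchwarz. Qed.

Lemma psd_diag_ge0 k (A : 'M[R]_k) i : psd A -> 0 <= A i i.
Proof. by move=> pA; rewrite -mxform_delta; exact: pA. Qed.

(* Vanishes when [A i i = 0], because [0^-1 = 0]; this is harmless, since [col i A]
   is then zero when [A] is positive semidefinite. *)
Definition pivot_col k (A : 'M[R]_k) (i : 'I_k) : 'cV[R]_k :=
  (Num.sqrt (A i i))^-1 *: col i A.

Lemma pivot_colE k (A : 'M[R]_k) i l :
  pivot_col A i l 0 = A l i / Num.sqrt (A i i).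
Proof. by rewrite !mxE mulrC. Qed.

Lemma pivot_col_le k (A : 'M[R]_k) i l : A^T = A -> psd A -> A l l <= A i i ->
  `|pivot_col A i l 0| <= pivot_col A i i 0.
Proof.
move=> sA pA li; rewrite !pivot_colE // normrM.
rewrite [X in _ * X]ger0_norm ?invr_ge0 ?sqrtr_ge0 //.
apply: ler_wpM2r; first by rewrite invr_ge0 sqrtr_ge0.
rewrite -(ler_pXn2r (n := 2)) ?nnegrE ?psd_diag_ge0 //.
rewrite real_normK ?num_real //; apply: le_trans (psd_entry l i sA pA) _.
by rewrite expr2; apply: ler_wpM2r => //; exact: psd_diag_ge0.
Qed.

Lemma pivot_col_sqr k (A : 'M[R]_k) i : psd A -> pivot_col A i i 0 ^+ 2 = A i i.
Proof.
move=> pA; rewrite pivot_colE // exprMn exprVn sqr_sqrtr ?psd_diag_ge0 //.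
have [->|Aii] := eqVneq (A i i) 0; first by rewrite expr0n mul0r.
by rewrite expr2 -mulrA divff // mulr1.
Qed.

(** The Schur complement of the entry [(i, i)], kept at full size: for symmetric positive
    semidefinite [A] its row and column [i] become zero. *)
Definition schur k (A : 'M[R]_k) (i : 'I_k) : 'M[R]_k :=
  A - pivot_col A i *m (pivot_col A i)^T.

Lemma schur_sym k (A : 'M[R]_k) i : A^T = A -> (schur A i)^T = schur A i.
Proof. by move=> sA; rewrite /schur linearB /= trmx_mul trmxK sA. Qed.

Lemma schurE k (A : 'M[R]_k) i a b :
  schur A i a b = A a b - pivot_col A i a 0 * pivot_col A i b 0.
Proof. by rewrite !mxE big_ord1 !mxE. Qed.

(** This is Cauchy-Schwarz for the form of [A] between [x] and the [i]-th basis vector. *)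
Lemma schur_psd k (A : 'M[R]_k) i : A^T = A -> psd A -> psd (schur A i).
Proof.
move=> sA pA x; have CS := mxform_CauchySchwarz x (delta_mx i 0) sA pA.
rewrite mxform_delta in CS.
have -> : (x^T *m schur A i *m x) 0 0 =
    mxform A x x - (mxform A x (delta_mx i 0) / Num.sqrt (A i i)) ^+ 2.
  have -> : mxform A x (delta_mx i 0) / Num.sqrt (A i i) = (x^T *m pivot_col A i) 0 0.
    by rewrite /mxform -mulmxA -colE -scalemxAr [in RHS]mxE mulrC.
  set u := pivot_col A i.
  have -> : x^T *m schur A i *m x = x^T *m A *m x - (x^T *m u) *m (x^T *m u)^T.
    by rewrite /schur -/u mulmxBr mulmxBl trmx_mul trmxK !mulmxA.
  have sub11 (P Q : 'M[R]_1) : (P - Q) 0 0 = P 0 0 - Q 0 0 by rewrite !mxE.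
  have sqr11 (P : 'M[R]_1) : (P *m P^T) 0 0 = P 0 0 ^+ 2.
    by rewrite mxE big_ord1 mxE expr2.
  by rewrite sub11 sqr11.
rewrite exprMn exprVn sqr_sqrtr ?psd_diag_ge0 // subr_ge0.
have [Aii|Aii] := eqVneq (A i i) 0.
  by rewrite Aii invr0 mulr0; exact: pA.
by rewrite ler_pdivrMr // lt_def Aii psd_diag_ge0.
Qed.

Lemma schur_pivot k (A : 'M[R]_k) i l : A^T = A -> psd A -> schur A i l i = 0.
Proof.
move=> sA pA; rewrite schurE !pivot_colE //.
have [Aii|Aii] := eqVneq (A i i) 0.
  have := psd_entry l i sA pA; rewrite Aii mulr0 => Al0.
  have /eqP : A l i ^+ 2 == 0 by rewrite eq_le Al0 sqr_ge0.
  by move=> /eqP; rewrite sqrf_eq0 => /eqP->; rewrite !mul0r subr0.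
rewrite mulrACA -invfM -expr2 sqr_sqrtr ?psd_diag_ge0 // mulfK ?subrr //.
Qed.

(** The last index is never a pivot. After [m] steps the remainder vanishes on the first [m] rows,
    so the factorization is exact there, and on the diagonal the remainder is nonnegative. Taking
    the largest remaining diagonal entry makes each pivot dominate the first [m] entries of its
    factor. *)
Lemma pivoted_cholesky m (A : 'M[R]_(m + 1)) : A^T = A -> psd A ->
  exists (pi : {perm 'I_m}) (z : 'I_m -> 'cV[R]_(m + 1)),
  [/\ forall i l, A (lshift 1 i) l = \sum_b z b (lshift 1 i) 0 * z b l 0,
      forall l, \sum_b z b l 0 ^+ 2 <= A l l,
      forall b a : 'I_m, (a < b)%N -> z b (lshift 1 (pi a)) 0 = 0,
      forall b i, `|z b (lshift 1 i) 0| <= z b (lshift 1 (pi b)) 0 &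
      forall b i : 'I_m, b = 0%N :> nat ->
        A (lshift 1 i) (lshift 1 i) <= z b (lshift 1 (pi b)) 0 ^+ 2].
Proof.
move=> sA pA.
(* Invariant after [q] steps: [s] records the pivots chosen, [z] the factors and [B] the remainder,
   which is zero on the rows already used. *)
have step q : (q <= m)%N -> exists (s : nat -> option 'I_m)
    (z : nat -> 'cV[R]_(m + 1)) (B : 'M[R]_(m + 1)),
  [/\ B^T = B, psd B, A = \sum_(b < q) z b *m (z b)^T + B &
      forall b, (b < q)%N -> exists i, [/\ s b = Some i,
        forall l, B (lshift 1 i) l = 0,
        forall a i', (a < b)%N -> s a = Some i' ->
          i' != i /\ z b (lshift 1 i') 0 = 0,
        forall l, `|z b (lshift 1 l) 0| <= z b (lshift 1 i) 0 &
        b = 0%N -> forall l,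
          A (lshift 1 l) (lshift 1 l) <= z b (lshift 1 i) 0 ^+ 2]].
  elim: q => [_|q IHq qm].
    by exists (fun=> None), (fun=> 0), A; split; rewrite // big_ord0 add0r.
  have [s [z [B [sB pB AE pivs]]]] := IHq (ltnW qm).
  pose free i := [forall a : 'I_q, s a != Some i].
  have [i0 i0free] : exists i, free i.
    apply/existsP; apply: contraT; rewrite negb_exists => /forallP used.
    have : (#|'I_m| <= #|[set s a | a : 'I_q]%SET|)%N.
      have Some_injective : injective (@Some 'I_m) by move=> ? ? [].
      rewrite -(card_imset _ Some_injective) subset_leq_card //.
      apply/fintype.subsetP => _ /imsetP[i _ ->].
      have := used i; rewrite negb_forall => /existsP[a]; rewrite negbK => /eqP<-.
      exact: imset_f.
    by move=> /leq_trans/(_ (leq_imset_card _ _)); rewrite !card_ord leqNgt qm.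
  have [i ifree imax] := @arg_maxP _ _ _ i0 free
    (fun i => B (lshift 1 i) (lshift 1 i)) i0free.
  have B0 l l' : ~~ free l -> B (lshift 1 l) l' = 0.
    rewrite negb_forall => /existsP[a]; rewrite negbK => /eqP sa.
    have [l0 [sl0 Bl0 _ _ _]] := pivs a (ltn_ord a).
    by move: sl0; rewrite sa => -[->]; exact: Bl0.
  (* Later factors vanish at earlier pivots: this is the triangular shape. *)
  have pB0 l : ~~ free l -> pivot_col B (lshift 1 i) (lshift 1 l) 0 = 0.
    by move=> lf; rewrite pivot_colE // B0 // mul0r.
  have Bmax l : B (lshift 1 l) (lshift 1 l) <= B (lshift 1 i) (lshift 1 i).
    have [lf|lf] := boolP (free l); first exact: imax.
    by rewrite B0 // psd_diag_ge0.
  pose s' b := if b == q then Some i else s b.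
  pose z' b := if b == q then pivot_col B (lshift 1 i) else z b.
  exists s', z', (schur B (lshift 1 i)); split.
  - exact: schur_sym.
  - exact: schur_psd.
  - rewrite big_ord_recr /= /z' eqxx /schur -addrA [X in _ + X]addrC subrK [LHS]AE.
    by congr (_ + _); apply: eq_bigr => b _; rewrite ltn_eqF.
  - move=> b; rewrite ltnS leq_eqVlt => /orP[/eqP->|bq].
      exists i; rewrite /s' /z' eqxx; split=> //.
      + move=> l; rewrite -(schur_sym _ sB) mxE; exact: schur_pivot.
      + move=> a i' aq; rewrite ltn_eqF // => sa.
        have nf : ~~ free i'.
          by rewrite negb_forall; apply/existsP; exists (Ordinal aq); rewrite sa eqxx.
        split; last exact: pB0.
        by apply: contraNneq nf => ->.
      + by move=> l; exact: pivot_col_le.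
      + move=> q0 l; rewrite pivot_col_sqr //.
        suff -> : A = B by exact: Bmax.
        by rewrite AE q0 big_ord0 add0r.
    have [i' [sb Bi' prev zb zb0]] := pivs b bq.
    exists i'; rewrite /s' /z' (ltn_eqF bq); split=> //.
      move=> l; have nf : ~~ free i'.
        by rewrite negb_forall; apply/existsP; exists (Ordinal bq); rewrite sb eqxx.
      by rewrite schurE pB0 // Bi' mul0r subr0.
    move=> a i'' ab; rewrite ltn_eqF ?(ltn_trans ab) //; exact: prev.
have [s [z [B [sB pB AE pivs]]]] := step m (leqnn m).
pose f (b : 'I_m) := odflt b (s b).
have fE (b : 'I_m) : s b = Some (f b).
  by have [i [sb _ _ _ _]] := pivs b (ltn_ord b); rewrite /f sb.
have f_neq (a b : 'I_m) : (a < b)%N -> f a != f b.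
  move=> ab; have [i [sb _ prev _ _]] := pivs b (ltn_ord b).
  have [+ _] := prev a (f a) ab (fE a).
  by move: sb; rewrite fE => -[<-].
have f_inj : injective f.
  move=> a b fab; apply/val_inj/eqP; apply: contraT; rewrite neq_ltn.
  by move=> /orP[] /f_neq; rewrite fab eqxx.
have B0 i l : B (lshift 1 i) l = 0.
  have [g gK fK] := injF_bij f_inj.
  have [i' [sb Bi' _ _ _]] := pivs (g i) (ltn_ord _).
  by move: sb; rewrite fE fK => -[->]; exact: Bi'.
have AEE i l : A i l = \sum_(b < m) z b i 0 * z b l 0 + B i l.
  rewrite [in LHS]AE mxE summxE; congr (_ + _); apply: eq_bigr => b _.
  by rewrite mxE big_ord1 !mxE.
exists (perm f_inj), (fun b => z (nat_of_ord b)); split.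
- by move=> i l; rewrite AEE B0 addr0.
- move=> l; rewrite AEE (eq_bigr (fun b : 'I_m => z b l 0 * z b l 0)) //.
  by rewrite lerDl psd_diag_ge0.
- move=> b a ab; rewrite permE.
  have [i [sb _ prev _ _]] := pivs b (ltn_ord b).
  by have [_] := prev a (f a) ab (fE a).
- move=> b i; rewrite permE; have [i' [sb _ _ zb _]] := pivs b (ltn_ord b).
  by move: sb; rewrite fE => -[->]; exact: zb.
- move=> b i b0; rewrite permE; have [i' [sb _ _ _ zb]] := pivs b (ltn_ord b).
  by move: sb; rewrite fE => -[->]; exact: zb.
Qed.

End Cholesky.

(** Level 0 collects everything below [M], including zero, which is why the lower bound is then
    absent. *)
Lemma level_exists (R : realType) (M J : nat) (y : R) :
  y <= M%:R ^+ J -> (1 < M)%N ->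
  exists l, [/\ (l <= J)%N, l = 0%N \/ M%:R ^+ l <= y & y < M%:R ^+ l.+1].
Proof.
move=> yJ M1; elim: J yJ => [|J IHJ] yJ.
  exists 0%N; split=> //; first by left.
  by apply: le_lt_trans yJ _; rewrite ltr_eXn2l // ltr1n.
have [yM|My] := ltP y (M%:R ^+ J.+1); last first.
  exists J.+1; split=> //; first by right.
  by apply: le_lt_trans yJ _; rewrite ltr_eXn2l // ltr1n.
have [yM'|My'] := leP y (M%:R ^+ J); last first.
  by exists J; split=> //; [right; exact: ltW].
by have [l [lJ *]] := IHJ yM'; exists l; split=> //; exact: leqW.
Qed.

(** The sphere has radius at least [1 / 2] because [c ord0 = 1], so some coordinate is away from its
    centre. A coordinate below [kappa] may be discarded, since it adds at most [3 kappa] to the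
    sphere equation. The selected one is thus also large, or is coordinate 0, which later gives its
    row a high level. *)
Lemma far_coordinate (R : realType) (m : nat) (x c : 'I_m.+1 -> R) (kappa : R) :
  0 < kappa -> (12 * m%:R + 10) * kappa <= 1 ->
  c ord0 = 1 -> (forall b, `|c b| <= 2) ->
  \sum_b x b ^+ 2 = \sum_b c b * x b ->
  exists t, kappa <= `|x t - c t / 2| /\ (t = ord0 \/ kappa <= `|x t|).
Proof.
(* Otherwise coordinate 0 contributes at most [kappa / 10 - 1 / 4] and each other one at most
   [3 kappa], which makes the sum of [x b ^ 2 - c b * x b] negative. *)
move=> k0 km c0 c2 sph; apply: contrapT => nex.
have small t : t = ord0 \/ kappa <= `|x t| -> `|x t - c t / 2| < kappa.
  by move=> ht; rewrite ltNge; apply/negP => kt; apply: nex; exists t.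
have k10 : 10 * kappa <= 1.
  by apply: le_trans km; apply: ler_wpM2r; [exact: ltW|rewrite lerDr mulr_ge0].
have sq_small u : `|u| < kappa -> u ^+ 2 <= kappa / 10.
  move=> uk; rewrite -real_normK ?num_real // expr2.
  have := normr_ge0 u; nra.
have x0 : x ord0 ^+ 2 - c ord0 * x ord0 <= kappa / 10 - 1 / 4.
  have := sq_small _ (small ord0 (or_introl erefl)); rewrite c0; lra.
have xb b : x b ^+ 2 - c b * x b <= 3 * kappa.
  have [kx|kx] := leP kappa `|x b|.
    have := sq_small _ (small b (or_intror kx)); have := sqr_ge0 (c b).
    have -> : x b ^+ 2 - c b * x b = (x b - c b / 2) ^+ 2 - c b ^+ 2 / 4 by field.
    lra.
  have := sq_small _ kx; have := ler_norm (- (c b * x b)).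
  rewrite normrN normrM => n1 n2.
  have : `|c b| * `|x b| <= 2 * kappa by apply: ler_pM => //; exact: ltW.
  lra.
have : 0 <= \sum_(b < m.+1) (x b ^+ 2 - c b * x b) by rewrite sumrB sph subrr.
rewrite big_ord_recl /=.
have : \sum_(b < m) (x (lift ord0 b) ^+ 2 - c (lift ord0 b) * x (lift ord0 b))
    <= \sum_(b < m) 3 * kappa by apply: ler_sum => b _; exact: xb.
by rewrite sumr_const card_ord -[X in _ <= X]mulr_natl; lra.
Qed.

(** Here [A] is the Gram matrix of the points together with one last vector, the diameter of the
    sphere starting at the origin; equality of [A i i] with the last entry of row [i] is the sphere
    equation. The coordinates of that vector in the Cholesky basis are the [c b]. *)
Lemma gram_near_degenerate (R : realType) (n m M J : nat)
    (A : 'M[R]_(m.+1 + 1)) (h : 'M[R]_(n, m.+1)) :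
  (12 * m + 10 <= M)%N ->
  A^T = A -> psd A ->
  (forall i, A (lshift 1 i) (lshift 1 i) = A (lshift 1 i) (rshift m.+1 ord0)) ->
  A (rshift m.+1 ord0) (rshift m.+1 ord0) <= 4 ->
  (forall i, A (lshift 1 i) (lshift 1 i) <= 1) ->
  (exists i, A (lshift 1 i) (lshift 1 i) = 1) ->
  (forall a i, `|h a i| <= M%:R) ->
  (forall a, \sum_i \sum_l h a i * A (lshift 1 i) (lshift 1 l) * h a l
     <= (M%:R ^+ 2 / M%:R ^+ J) ^+ 2) ->
  degenerate M J h.
Proof.
move=> mM sA pA Asph A4 A1 [i1 Ai1] hM hA.
have [pi [z [zE zD zU zP z0]]] := pivoted_cholesky sA pA.
pose Z : 'M[R]_m.+1 := \matrix_(b, p) z b (lshift 1 (pi p)) 0.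
pose c b := z b (rshift m.+1 ord0) 0.
have M1 : (1 < M)%N by lia.
have M0 : 0 < M%:R :> R by rewrite ltr0n; lia.
have N0 : 0 < M%:R ^+ J :> R by rewrite exprn_gt0.
have Zge0 b : 0 <= Z b b by rewrite mxE; apply: le_trans (zP b (pi b)).
have zle1 b i : z b (lshift 1 i) 0 ^+ 2 <= 1.
  apply: le_trans (A1 i); apply: le_trans (zD _).
  rewrite (bigD1 b) //= lerDl; apply: sumr_ge0 => b' _; exact: sqr_ge0.
have Zle1 b : Z b b <= 1.
  rewrite -(ler_pXn2r (n := 2)) ?nnegrE // expr1n mxE; exact: zle1.
have Z00 : Z ord0 ord0 = 1.
  apply/eqP; rewrite eq_le Zle1 /= -(ler_pXn2r (n := 2)) ?nnegrE //.
  by rewrite expr1n -Ai1 mxE; exact: z0.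
(* The first pivot is the point of norm 1, whose only nonzero coordinate is the first; its sphere
   equation reads [1 = c ord0]. *)
have c0 : c ord0 = 1.
  have := zE (pi ord0) (rshift m.+1 ord0); rewrite -Asph zE.
  rewrite (bigD1 ord0) //= [in RHS](bigD1 ord0) //=.
  have zb0 b : b != ord0 -> z b (lshift 1 (pi ord0)) 0 = 0.
    by move=> b0; apply: zU; rewrite lt0n.
  rewrite !big1 ?addr0; [|by move=> b /zb0->; rewrite mul0r..].
  by move: Z00; rewrite mxE => ->; rewrite !mul1r.
have c2 b : `|c b| <= 2.
  rewrite -(ler_pXn2r (n := 2)) ?nnegrE // real_normK ?num_real //.
  apply: le_trans (_ : 4 <= _); last by rewrite expr2; lra.
  apply: le_trans A4; apply: le_trans (zD _).
  rewrite (bigD1 b) //= lerDl; apply: sumr_ge0 => b' _; exact: sqr_ge0.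
have sph p : \sum_b Z b p ^+ 2 = \sum_b c b * Z b p.
  have := zE (pi p) (rshift m.+1 ord0); rewrite -Asph zE => e.
  rewrite (eq_bigr (fun b => z b (lshift 1 (pi p)) 0 * z b (lshift 1 (pi p)) 0)).
    by rewrite e; apply: eq_bigr => b _; rewrite mxE mulrC.
  by move=> b _; rewrite mxE.
have lev b : exists l, [/\ (l <= J)%N, l = 0%N \/ M%:R ^+ l <= Z b b * M%:R ^+ J
    & Z b b * M%:R ^+ J < M%:R ^+ l.+1].
  apply: level_exists => //; rewrite -[leRHS]mul1r.
  by apply: ler_wpM2r; [exact: ltW|exact: Zle1].
have [j jP] := choice lev.
have far p : exists t, M%:R^-1 <= `|Z t p - c t / 2|
    /\ (t = ord0 \/ M%:R^-1 <= `|Z t p|).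
  apply: (far_coordinate (x := fun b => Z b p)) => //; first by rewrite invr_gt0.
  rewrite ler_pdivrMr // mul1r -(natrM R 12 m) -(natrD R _ 10) ler_nat //.
have [t tP] := choice far.
have ZP b p : `|Z b p| <= Z b b by rewrite !mxE; exact: zP.
have ZU (b p : 'I_m.+1) : (p < b)%N -> Z b p = 0 by move=> pb; rewrite mxE zU.
have j0 : j ord0 = J.
  have [lJ _] := jP ord0; rewrite Z00 mul1r ltr_eXn2l ?ltr1n // => Jl.
  by apply/eqP; rewrite eqn_leq lJ -ltnS.
exists pi, j, t, (fun p => Z (t p) p - c (t p) / 2 < 0), Z, c; split=> //.
- by move=> b; have [] := jP b.
- move=> p; have [_ [->//|tp]] := tP p; rewrite leqNgt; apply/negP => /ZU Z0.
  by move: tp; rewrite Z0 normr0 invr_le0 leNgt M0.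
split=> //.
- by move=> b; have [] := jP b.
- by move=> b; have [_ _ /ltW] := jP b.
- move=> p; have [_ [->|tp]] := tP p; first by rewrite j0 leq_addr.
  have [_ _ hi] := jP (t p).
  have : M%:R^-1 * M%:R ^+ J < M%:R ^+ (j (t p)).+1 :> R.
    apply: le_lt_trans hi; apply: ler_wpM2r; first exact: ltW.
    exact: le_trans tp (ZP _ _).
  by rewrite ltr_pdivrMl // -exprS ltr_eXn2l ?ltr1n //; lia.
- move=> p; have [tp _] := tP p; apply: le_trans tp _.
  by case: ltP => [/ltr0_norm->|/ger0_norm->]; rewrite ?expr1 ?expr0 ?mul1r ?mulN1r.
- move=> a b; rewrite -ler_pdivlMr //.
  rewrite -(ler_pXn2r (n := 2)) ?nnegrE ?divr_ge0 ?exprn_ge0 ?(ltW M0) //.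
  rewrite real_normK ?num_real //; apply: le_trans _ (hA a).
  (* In Cholesky coordinates the quadratic form of [A] at row [a] of [h] is a sum of squares over
     [b], so it bounds each of them. *)
  have -> : \sum_p h a (pi p) * Z b p = \sum_i h a i * z b (lshift 1 i) 0.
    rewrite [RHS](reindex_inj (h := pi)) /=; last exact: perm_inj.
    by apply: eq_bigr => p _; rewrite mxE.
  have -> : \sum_i \sum_l h a i * A (lshift 1 i) (lshift 1 l) * h a l
      = \sum_b' (\sum_i h a i * z b' (lshift 1 i) 0) ^+ 2.
    under [RHS]eq_bigr do rewrite expr2 mulr_suml.
    rewrite [RHS]exchange_big; apply: eq_bigr => i _ /=.
    under [RHS]eq_bigr do rewrite mulr_sumr.
    rewrite [RHS]exchange_big; apply: eq_bigr => l _ /=.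
    rewrite zE mulr_sumr mulr_suml; apply: eq_bigr => b' _; ring.
  rewrite [leRHS](bigD1 b) //= lerDl; apply: sumr_ge0 => b' _; exact: sqr_ge0.
Qed.

(** * From the optimal point of the relaxation to a Gram matrix *)

Section FormLinear.
Variables (R : realType) (k : nat) (A : 'M[R]_k).

Lemma mxformDr x y y' : mxform A x (y + y') = mxform A x y + mxform A x y'.
Proof. by rewrite /mxform mulmxDr mxE. Qed.

Lemma mxformZr x a y : mxform A x (a *: y) = a * mxform A x y.
Proof. by rewrite /mxform -scalemxAr mxE. Qed.

Lemma mxformDl x x' y : mxform A (x + x') y = mxform A x y + mxform A x' y.
Proof.
rewrite /mxform; have -> : (x + x')^T = x^T + x'^T by rewrite linearD.
by rewrite !mulmxDl mxE.
Qed.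

Lemma mxformZl a x y : mxform A (a *: x) y = a * mxform A x y.
Proof.
rewrite /mxform; have -> : (a *: x)^T = a *: x^T by rewrite linearZ.
by rewrite -!scalemxAl mxE.
Qed.

Lemma mxform_sum (I : finType) (a : I -> R) (x : I -> 'cV[R]_k) :
  mxform A (\sum_i a i *: x i) (\sum_i a i *: x i)
  = \sum_i \sum_l a i * mxform A (x i) (x l) * a l.
Proof.
have lin0 y : mxform A 0 y = 0 by rewrite -(scale0r (0 : 'cV_k)) mxformZl mul0r.
have lin0r y : mxform A y 0 = 0 by rewrite -(scale0r (0 : 'cV_k)) mxformZr mul0r.
have sumr y : mxform A y (\sum_i a i *: x i) = \sum_i mxform A y (x i) * a i.
  rewrite (big_morph _ (mxformDr y) (lin0r y)).
  by apply: eq_bigr => i _; rewrite mxformZr mulrC.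
rewrite [LHS](big_morph (mxform A ^~ _) (fun u v => mxformDl u v _) (lin0 _)).
apply: eq_bigr => i _; rewrite mxformZl sumr mulr_sumr.
by apply: eq_bigr => l _; rewrite mulrA.
Qed.

End FormLinear.

Lemma psd_gram (R : realType) k l (A : 'M[R]_k) (x : 'I_l -> 'cV[R]_k) :
  psd A -> psd (\matrix_(p, q) mxform A (x p) (x q)).
Proof.
move=> pA u; rewrite -/(mxform _ _ _) mxformE.
have := pA (\sum_p u p 0 *: x p); rewrite -/(mxform _ _ _) mxform_sum.
by congr (_ <= _); apply: eq_bigr => p _; apply: eq_bigr => q _; rewrite mxE.
Qed.

Lemma mxtrace_form (R : realType) n k (G : 'M[R]_(n, k)) (X : 'M[R]_k) :
  \tr (G^T *m G *m X) = \sum_a mxform X (row a G)^T (row a G)^T.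
Proof.
rewrite -mulmxA mxtrace_mulC /mxtrace; apply: eq_bigr => a _.
rewrite /mxform trmxK -row_mul [LHS]mxE [RHS]mxE.
by apply: eq_bigr => l _; rewrite !mxE.
Qed.

Lemma sdr_LE (R : realType) n m (H : 'M[R]_(n, m)) (y : 'cV[R]_n) :
  sdr_L H y = (row_mx H (- y))^T *m row_mx H (- y).
Proof.
rewrite tr_row_mx mul_col_row; have -> : (- y)^T = - y^T by rewrite linearN.
by rewrite !mulmxN !mulNmx opprK.
Qed.

Lemma sgn_error (R : realType) (x u : R) :
  u = 1 \/ u = -1 -> sgn x != u -> u * x <= 0.
Proof.
rewrite /sgn; case=> ->; case: ltP => x0; rewrite ?eqxx // => _.
  by rewrite mul1r.
by rewrite mulN1r oppr_le0 ltW.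
Qed.

(** The optimum is compared with the rank-one feasible point built from [(s, 1)], whose objective
    value is the squared norm of [v]. *)
Lemma sdr_optimal_residual (R : realType) n m (H : 'M[R]_(n, m)) (s : 'cV[R]_m)
    (v : 'cV[R]_n) (X : 'M[R]_(m + 1)) :
  (forall i, s i 0 = 1 \/ s i 0 = -1) -> sdr_optimal (sdr_L H (H *m s + v)) X ->
  \sum_a mxform X (row a (row_mx H (- (H *m s + v))))^T
                  (row a (row_mx H (- (H *m s + v))))^T
    <= \sum_a v a 0 ^+ 2.
Proof.
move=> s1 [_ opt]; set y := H *m s + v; set G := row_mx H (- y).
pose e : 'cV[R]_(m + 1) := col_mx s 1%:M.
have sqr11 (w : 'M[R]_1) : (w *m w^T) 0 0 = w 0 0 ^+ 2.
  by rewrite mxE big_ord1 mxE expr2.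
have feas : sdr_feasible (e *m e^T).
  split; first by rewrite trmx_mul trmxK.
  split=> [i|x].
    rewrite mxE big_ord1 !mxE; case: splitP => l _.
      by case: (s1 l) => ->; rewrite ?mulr1 ?mulrNN ?mulr1.
    by rewrite !ord1 ?mxE ?eqxx /= mulr1.
  have -> : x^T *m (e *m e^T) *m x = (x^T *m e) *m (x^T *m e)^T.
    by rewrite trmx_mul trmxK !mulmxA.
  by rewrite sqr11 sqr_ge0.
have := opt _ feas; rewrite sdr_LE -/y -/G mxtrace_form => /le_trans; apply.
have -> : \tr (G^T *m G *m (e *m e^T)) = \tr ((G *m e) *m (G *m e)^T).
  by rewrite trmx_mul [RHS]mxtrace_mulC mulmxA [LHS]mxtrace_mulC !mulmxA.
have -> : G *m e = - v.
  by rewrite mul_row_col mulmx1 /y opprD addrA subrr sub0r.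
have -> : (- v)^T = - v^T by rewrite linearN.
rewrite mulNmx mulmxN opprK /mxtrace.
by apply: ler_sum => a _; rewrite mxE big_ord1 mxE expr2.
Qed.

Lemma sdr_error_near_degenerate (R : realType) (n m M J : nat)
    (H : 'M[R]_(n, m.+1)) (s : 'cV[R]_m.+1) (v : 'cV[R]_n)
    (X : 'M[R]_(m.+1 + 1)) :
  (12 * m + 10 <= M)%N ->
  (forall i, s i 0 = 1 \/ s i 0 = -1) -> sdr_optimal (sdr_L H (H *m s + v)) X ->
  \col_i sgn (X (lshift 1 i) (rshift m.+1 ord0)) != s ->
  (forall a i, `|H a i| <= M%:R) ->
  2 * \sum_a v a 0 ^+ 2 <= (M%:R ^+ 2 / M%:R ^+ J) ^+ 2 ->
  degenerate M J (\matrix_(a, i) (H a i * s i 0)).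
Proof.
move=> mM s1 optX err HM vM; have res := sdr_optimal_residual s1 optX.
have [[sX [dX pX]] _] := optX.
have ss i : s i 0 * s i 0 = 1 by case: (s1 i) => ->; rewrite ?mulrNN mulr1.
set last := rshift m.+1 ord0 in err *.
(* With [X] the Gram matrix of unit vectors [x_p], these are the coefficients of [s_i x_i - x_last]
   and of [-2 x_last]. The former lie on the unit sphere centred at [- x_last], of which the latter
   is the diameter from the origin. *)
pose k (p : 'I_(m.+1 + 1)) : 'cV[R]_(m.+1 + 1) := match fintype.split p with
  | inl i => s i 0 *: delta_mx p 0 + (-1) *: delta_mx last 0
  | inr _ => (-2) *: delta_mx last 0 end.
pose A0 := \matrix_(p, q) mxform X (k p) (k q).
have kl i : k (lshift 1 i) = s i 0 *: delta_mx (lshift 1 i) 0 + (-1) *: delta_mx last 0.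
  by rewrite /k (unsplitK (inl i)).
have kr : k last = (-2) *: delta_mx last 0 by rewrite /k (unsplitK (inr ord0)).
have expand := (mxformDl, mxformDr, mxformZl, mxformZr, mxform_delta).
have Xsym p q : X p q = X q p by rewrite -[in LHS]sX mxE.
have A0l i : A0 (lshift 1 i) (lshift 1 i) = 2 - 2 * (s i 0 * X (lshift 1 i) last).
  rewrite mxE !kl !expand !dX (Xsym last); have := ss i; lra.
have A0lr i : A0 (lshift 1 i) last = 2 - 2 * (s i 0 * X (lshift 1 i) last).
  rewrite mxE kl kr !expand !dX; lra.
have A0r : A0 last last = 4 by rewrite mxE kr !expand !dX; lra.
have sA0 : A0^T = A0.
  by apply/matrixP => p q; rewrite !mxE mxformC.
have pA0 : psd A0 by exact: psd_gram.
(* A wrong sign at [i] means [s_i X_(i, last) <= 0], so the squared norm [2 - 2 s_i X_(i, last)] is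
   at least 2. *)
have [i0 i0err] : exists i, 2 <= A0 (lshift 1 i) (lshift 1 i).
  apply: contrapT => none; move/eqP: err; apply; apply/colP => i.
  rewrite mxE; apply/eqP; apply: contraT => /(sgn_error (s1 i)) neg; exfalso.
  by apply: none; exists i; rewrite A0l; lra.
have [i1 _ i1max] := @arg_maxP _ _ _ i0 xpredT
  (fun i => A0 (lshift 1 i) (lshift 1 i)) isT.
set al := A0 (lshift 1 i1) (lshift 1 i1) in i1max.
have al2 : 2 <= al by apply: le_trans i0err (i1max _ _).
have al0 : 0 < al by lra.
have AE p q : (al^-1 *: A0) p q = al^-1 * A0 p q by rewrite mxE.
apply: (gram_near_degenerate (A := al^-1 *: A0)) => //.
- by rewrite linearZ /= sA0.
- move=> x; rewrite -scalemxAr -scalemxAl mxE mulr_ge0 ?invr_ge0 ?(ltW al0) //.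
- by move=> i; rewrite !AE A0l A0lr.
- by rewrite AE A0r ler_pdivrMl //; lra.
- by move=> i; rewrite AE ler_pdivrMl // mulr1; exact: i1max.
- by exists i1; rewrite AE mulVf // gt_eqF.
- by move=> a i; rewrite mxE normrM; case: (s1 i) => ->; rewrite ?normrN normr1 mulr1.
move=> a; set G := row_mx H _ in res.
have res_a : mxform X (row a G)^T (row a G)^T <= \sum_a v a 0 ^+ 2.
  apply: le_trans res; rewrite [leRHS](bigD1 a) //= lerDl.
  by apply: sumr_ge0 => b _; exact: pX.
have v_a : v a 0 ^+ 2 <= \sum_a v a 0 ^+ 2.
  by rewrite [leRHS](bigD1 a) //= lerDl; apply: sumr_ge0 => b _; exact: sqr_ge0.
(* Since [s_i ^ 2 = 1], the noiseless part of [y] is restored and only [v a] remains as a correction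
   to row [a] of [G]. *)
have PE : \sum_i (H a i * s i 0) *: k (lshift 1 i)
    = (row a G)^T + v a 0 *: delta_mx last 0.
  apply/colP => p; rewrite summxE !mxE; case: splitP => l pl.
    have pE : p = lshift 1 l by apply/val_inj.
    rewrite (bigD1 l) //= big1 => [|i il].
      by rewrite kl pE !mxE !eqxx eq_lrshift /= !mulr0 mulr1 !addr0 -mulrA ss mulr1.
    rewrite kl pE !mxE (inj_eq (@lshift_inj _ _)) eq_sym (negPf il) eq_lrshift.
    by rewrite /= !mulr0 addr0 mulr0.
  have pE : p = last by apply/val_inj; rewrite /= pl ord1.
  rewrite pE !mxE !ord1 !eqxx /= mulr1 opprD subrK -sumrN; apply: eq_bigr => i _.
  by rewrite kl !mxE eq_rlshift !eqxx /= mulr0 add0r mulr1 mulrN1.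
have -> : \sum_i \sum_l (\matrix_(a, i) (H a i * s i 0)) a i
      * (al^-1 *: A0) (lshift 1 i) (lshift 1 l)
      * (\matrix_(a, i) (H a i * s i 0)) a l =
    al^-1 * mxform X ((row a G)^T + v a 0 *: delta_mx last 0)
                     ((row a G)^T + v a 0 *: delta_mx last 0).
  rewrite -PE mxform_sum mulr_sumr; apply: eq_bigr => i _.
  rewrite mulr_sumr; apply: eq_bigr => l _; rewrite AE !mxE; ring.
rewrite ler_pdivrMl // mxformDZ // mxform_delta dX mulr1.
(* With [w ^ 2 <= g] and [2 v w <= v ^ 2 + w ^ 2], the form is at most [2 g + 2 v ^ 2], hence four
   times the squared norm of the noise; the normalization [al >= 2] removes half of it. *)
have := mxform_CauchySchwarz (row a G)^T (delta_mx last 0) sX pX.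
rewrite mxform_delta dX mulr1; move: (mxform _ _ (delta_mx _ _)) => w w2.
have := sqr_ge0 (v a 0 - w); have : 2 * (M%:R ^+ 2 / M%:R ^+ J) ^+ 2
    <= al * (M%:R ^+ 2 / M%:R ^+ J) ^+ 2 :> R.
  by apply: ler_wpM2r => //; exact: sqr_ge0.
move: (_ / _) res_a v_a w2 vM => y; move: (mxform _ _ _) (\sum__ _) => g S; lra.
Qed.

(** * Gaussian estimates *)

Lemma normal_prob_itv (R : realType) (sigma a b : R) :
  0 < sigma -> a <= b ->
  (normal_prob 0 sigma `[a, b] <= (normal_peak sigma * (b - a))%:E)%E.
Proof.
move=> s0 ab; have sn0 : sigma != 0 by rewrite gt_eqF.
apply: (@le_trans _ _ (\int[lebesgue_measure]_(x in `[a, b]) (normal_peak sigma)%:E)%E).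
  apply: ge0_le_integral => //=.
  - by move=> x _; rewrite lee_fin normal_pdf_ge0.
  - apply/measurable_EFinP; apply: measurable_funTS; exact: measurable_normal_pdf.
  - by move=> x _; rewrite lee_fin normal_pdf_ub.
rewrite integral_cst //= lebesgue_measure_itv /= lte_fin.
case: ltP => [_|ba]; first by rewrite -EFinD -EFinM.
by rewrite mule0 lee_fin mulr_ge0 ?subr_ge0 // normal_peak_ge0.
Qed.

(** Half of the exponent is bounded by its value at [M]; the other half is, up to the ratio of the
    peaks, the density of standard deviation [tau], whose integral is at most 1. *)
Lemma normal_prob_tail (R : realType) (sigma : R) : 0 < sigma ->
  exists2 K : R, 0 <= K & forall M : R, 0 <= M ->
  (normal_prob 0 sigma [set x | (M < `|x|)%R]
     <= (K * expR (- M ^+ 2 / (4 * sigma ^+ 2)))%:E)%E.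
Proof.
move=> s0; pose tau := Num.sqrt 2 * sigma.
have sn0 : sigma != 0 by rewrite gt_eqF.
have t0 : 0 < tau by rewrite mulr_gt0 // sqrtr_gt0.
have tn0 : tau != 0 by rewrite gt_eqF.
have tauE : tau ^+ 2 = 2 * sigma ^+ 2 by rewrite exprMn sqr_sqrtr.
pose K := normal_peak sigma / normal_peak tau.
have K0 : 0 <= K by rewrite divr_ge0 // normal_peak_ge0.
exists K => // M M0; set A := [set x | _]; set e := expR _.
have mA : measurable A.
  rewrite [A](_ : _ = (fun x : R => `|x|) @^-1` `]M, +oo[).
    by rewrite -[X in measurable X]setTI; exact: normr_measurable.
  by apply/seteqP; split => x /=; rewrite in_itv /= andbT.
have pdf_le x : A x -> normal_pdf 0 sigma x <= K * e * normal_pdf 0 tau x.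
  move=> Ax; rewrite !normal_pdfE //= /normal_fun /K.
  have -> : normal_peak sigma / normal_peak tau * e *
      (normal_peak tau * expR (- (x - 0) ^+ 2 / (tau ^+ 2 *+ 2)))
    = normal_peak sigma * (e * expR (- (x - 0) ^+ 2 / (tau ^+ 2 *+ 2))).
    by field; rewrite gt_eqF // normal_peak_gt0.
  apply: ler_wpM2l; first exact: normal_peak_ge0.
  rewrite /e -expRD ler_expR subr0 tauE.
  have M2 : M ^+ 2 <= x ^+ 2.
    by rewrite -[leRHS]real_normK ?num_real // ler_pXn2r ?nnegrE // ltW.
  have -> : - x ^+ 2 / (sigma ^+ 2 *+ 2)
      = - x ^+ 2 / (4 * sigma ^+ 2) + - x ^+ 2 / (2 * sigma ^+ 2 *+ 2).
    by field.
  by rewrite lerD2r ler_wpM2r ?lerN2 // invr_ge0 mulr_ge0 // sqr_ge0.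
apply: (@le_trans _ _
    (\int[lebesgue_measure]_(x in A) (K * e * normal_pdf 0 tau x)%:E)%E).
  apply: ge0_le_integral => //=.
  - by move=> x _; rewrite lee_fin normal_pdf_ge0.
  - apply/measurable_EFinP; apply: measurable_funTS; exact: measurable_normal_pdf.
  - apply/measurable_EFinP; apply: measurable_funTS; apply: measurable_funM => //.
    exact: measurable_normal_pdf.
have Ke : 0 <= K * e by rewrite mulr_ge0 // expR_ge0.
have -> : (\int[lebesgue_measure]_(x in A) (K * e * normal_pdf 0 tau x)%:E
    = (K * e)%:E * \int[lebesgue_measure]_(x in A) (normal_pdf 0 tau x)%:E)%E.
  rewrite -ge0_integralZl_EFin //.
  - by move=> x _; rewrite lee_fin normal_pdf_ge0.
  - apply/measurable_EFinP; apply: measurable_funTS; exact: measurable_normal_pdf.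
rewrite -[leRHS]mule1; apply: lee_wpmul2l; first by rewrite lee_fin.
rewrite -(@integral_normal_pdf R 0 tau); apply: ge0_subset_integral => //=.
- by apply/measurable_EFinP; exact: measurable_normal_pdf.
- by move=> x _; rewrite lee_fin normal_pdf_ge0.
Qed.

(** * Union bound and independent boxes *)

Section FiniteProbability.
Context {R : realType} {d : measure_display} {T : measurableType d}.
Variable P : probability T R.

Lemma probability_cover (I : finType) (E : set T) (F : I -> set T) (b : I -> R) :
  measurable E -> (forall i, measurable (F i)) ->
  (forall w, E w -> exists i, F i w) ->
  (forall i, (P (F i) <= (b i)%:E)%E) -> (P E <= (\sum_i b i)%:E)%E.
Proof.
move=> mE mF EF Fb; set U := \big[setU/set0]_(i <- index_enum I) F i.
have mU : measurable U by apply: bigsetU_measurable.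
have EU : E `<=` U.
  by move=> w /EF[i Fi]; rewrite /U -bigcup_seq; exists i => //=; exact: mem_index_enum.
apply: le_trans (_ : (P U <= _)%E); first by apply: le_measure; rewrite ?inE.
rewrite /U {EU mU}; elim: (index_enum I) => [|i r IHr].
  by rewrite !big_nil measure0.
rewrite !big_cons EFinD; apply: le_trans (leeD (Fb i) IHr).
by apply: measureU2 => //; exact: bigsetU_measurable.
Qed.

Lemma measurable_forall_preimage (I : finType) (X : I -> {RV P >-> R})
    (A : I -> set R) : (forall i, measurable (A i)) ->
  measurable [set w | forall i, A i (X i w)].
Proof.
move=> mA; have -> : [set w | forall i, A i (X i w)] =
    \bigcap_(i in [set: I]) (X i @^-1` A i).
  by apply/seteqP; split=> w /= h i; [move=> _; exact: h|exact: h].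
apply: fin_bigcap_measurable; first exact: finite_finset.
by move=> i _; rewrite -[X in measurable X]setTI; exact: measurable_funP.
Qed.

Lemma independent_box_le (I : finType) (X : I -> {RV P >-> R})
    (A : I -> set R) (b : I -> R) :
  mutually_independent P (fun i => (X i : T -> R)) ->
  (forall i, measurable (A i)) ->
  (forall i, (P (X i @^-1` A i) <= (b i)%:E)%E) ->
  (P [set w | forall i, A i (X i w)] <= (\prod_i b i)%:E)%E.
Proof.
move=> ind mA Ab; rewrite ind //.
suff : (0 <= \prod_i P (X i @^-1` A i) <= (\prod_i b i)%:E)%E by case/andP.
elim/big_ind2: _ => [|x1 x2 y1 y2 /andP[x0 xy] /andP[y0 yy]|i _].
- by rewrite lee01 lexx.
- by rewrite mule_ge0 // EFinM lee_pmul.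
- by rewrite measure_ge0 Ab.
Qed.

End FiniteProbability.

(** * Error probability *)

(** The discrete data of a degenerate matrix. Their number does not depend on [M], so summing over
    them only changes a constant. *)
Definition skeleton (m J : nat) : finType :=
  ({perm 'I_m.+1} * {ffun 'I_m.+1 -> 'I_J.+1} * {ffun 'I_m.+1 -> 'I_m.+1}
   * {ffun 'I_m.+1 -> bool})%type.

Lemma card_degenerate (R : realType) (n m r M J : nat) (T : finType)
    (S : {set T}) (G : T -> 'M[int]_(n, m.+1)) :
  (m + 10 <= M)%N -> m.+1 = (n + r)%N -> injective G ->
  (forall f, f \in S -> exists h : 'M[R]_(n, m.+1),
     degenerate M J h /\ forall a i, G f a i = Num.floor (h a i * M%:R ^+ J)) ->
  (#|S| <= #|skeleton m J| * M ^ (n * m * J + 'C(r.+1, 2) * J + 9 * m.+1 * (m.+1 + n)))%N.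
Proof.
move=> mM mnr Ginj SG.
pose good (k : skeleton m J) f := exists (h : 'M[R]_(n, m.+1)) z c,
  [/\ k.1.1.2 ord0 = J :> nat, forall p, (k.1.2 p <= p)%N,
      near_degenerate M J k.1.1.1 (fun b => k.1.1.2 b : nat) k.1.2 k.2 h z c &
      forall a i, G f a i = Num.floor (h a i * M%:R ^+ J)].
pose Sk (k : skeleton m J) := [set f in S | `[< good k f >]]%SET.
have SU : S \subset (\bigcup_k Sk k)%SET.
  apply/fintype.subsetP => f fS.
  have [h [[pi [j [t [sg [z [c [jJ j0 tle nd]]]]]]] GE]] := SG f fS.
  pose jj := [ffun b => inord (j b) : 'I_J.+1].
  have jjE : (fun b => jj b : nat) = j.
    by apply/funext => b; rewrite ffunE inordK // ltnS.
  have tE : [ffun p => t p] = t :> ('I_m.+1 -> _) by apply/funext => p; rewrite ffunE.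
  have sE : [ffun p => sg p] = sg :> ('I_m.+1 -> _) by apply/funext => p; rewrite ffunE.
  apply/finset.bigcupP; exists (pi, jj, [ffun p => t p], [ffun p => sg p]) => //.
  rewrite inE fS /=; apply/asboolP; exists h, z, c; rewrite /= jjE tE sE.
  by split=> //; rewrite ffunE inordK ?ltnS ?jJ ?j0.
apply: leq_trans (subset_leq_card SU) _.
apply: leq_trans (_ : \sum_k #|Sk k| <= _)%N.
  elim/big_rec2: _ => [|k u A _ h]; first by rewrite cards0.
  by apply: leq_trans (leq_card_setU _ _) _; exact: leq_add.
rewrite -sum_nat_const; apply: leq_sum => k _.
have [->|[f0]] := set_0Vmem (Sk k); first by rewrite cards0.
rewrite inE => /andP[_ /asboolP[_ [_ [_ [j0 tle _ _]]]]].
apply: (card_near_degenerate (R := R) (pi := k.1.1.1)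
  (j := fun b => k.1.1.2 b : nat) (t := k.1.2) (sg := k.2) mM mnr Ginj) => //.
  by move=> b; rewrite -ltnS.
move=> f; rewrite inE => /andP[_ /asboolP[h [z [c [_ _ nd GE]]]]].
by exists h, z, c.
Qed.

(** One term of the exponential series gives [exp (- y) <= (q + 1)! / y ^ (q + 1)], with [y]
    proportional to [M ^ 2]. *)
Lemma normal_prob_tail_pow (R : realType) (sigma : R) (q : nat) : 0 < sigma ->
  exists2 K : R, 0 <= K & forall M : nat, (0 < M)%N ->
  (normal_prob 0 sigma [set x | (M%:R < `|x|)%R] <= (K / M%:R ^+ q)%:E)%E.
Proof.
move=> s0; have [K K0 tail] := normal_prob_tail s0.
pose a : R := 4 * sigma ^+ 2.
have a0 : 0 < a by rewrite mulr_gt0 // exprn_gt0.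
exists (K * (q.+1`!%:R * a ^+ q.+1)).
  by rewrite !mulr_ge0 // exprn_ge0 // ltW.
move=> M M0; apply: le_trans (tail _ (ler0n _ _)) _.
have M1 : 1 <= M%:R :> R by rewrite ler1n.
rewrite lee_fin -mulrA; apply: ler_wpM2l => //.
rewrite mulNr expRN; set y := _ / _.
have y0 : 0 < y by rewrite divr_gt0 // exprn_gt0 //; lra.
have := expR_ge1Dxn q (ltW y0) => ey.
have ypos : 0 < y ^+ q.+1 / q.+1`!%:R.
  by rewrite divr_gt0 ?exprn_gt0 // ltr0n fact_gt0.
apply: (@le_trans _ _ (y ^+ q.+1 / q.+1`!%:R)^-1).
  by rewrite lef_pV2 ?posrE ?expR_gt0 //; lra.
have -> : (y ^+ q.+1 / q.+1`!%:R)^-1 = q.+1`!%:R * a ^+ q.+1 / (M%:R ^+ 2) ^+ q.+1.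
  by rewrite invf_div /y expr_div_n invf_div mulrA.
apply: ler_wpM2l; first by rewrite mulr_ge0 // exprn_ge0 // ltW.
rewrite -exprM lef_pV2 ?posrE ?exprn_gt0 //; [|lra..].
by rewrite ler_weXn2l //; lia.
Qed.

Lemma exponent_balance (n m J k c : nat) : (k <= n)%N ->
  (n * m * J + k * J + c + J * (n - k) = J * (n * m.+1) + c)%N.
Proof. by move=> kn; nia. Qed.

Lemma floor_cell (R : realType) (x N : R) : 0 < N ->
  (Num.floor (x * N))%:~R / N <= x <= ((Num.floor (x * N))%:~R + 1) / N.
Proof.
move=> N0; rewrite ler_pdivrMr // ler_pdivlMr // floor_le /= ltW //.
by have := floorD1_gt (x * N); rewrite intrD.
Qed.

Section ErrorProbability.
Context {R : realType} {d : measure_display} {T : measurableType d}.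
Variable P : probability T R.

Lemma fair_sign_ae (Y : {RV P >-> R}) :
  P (Y @^-1` [set 1]) = (1 / 2)%:E -> P (Y @^-1` [set -1]) = (1 / 2)%:E ->
  P (Y @^-1` (~` ([set 1] `|` [set -1]))) = 0%E.
Proof.
move=> Y1 YN1; have mY A : measurable A -> measurable (Y @^-1` A).
  by move=> mA; rewrite -[X in measurable X]setTI; exact: measurable_funP.
rewrite -preimage_setC probability_setC; last by apply: mY; exact: measurableU.
rewrite preimage_setU measureU; [|exact: mY|exact: mY|].
  transitivity (1 - ((1 / 2)%:E + (1 / 2)%:E) : \bar R)%E.
    by congr (1 - (_ + _))%E.
  have -> : ((1 / 2)%:E + (1 / 2)%:E = 1 :> \bar R)%E.
    by rewrite -EFinD; congr EFin; field.
  by rewrite subee.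
apply/seteqP; split=> // w [/= -> /eqP].
by rewrite -subr_eq0 opprK; move/eqP; lra.
Qed.

Variables (n m r J : nat) (sigma : R).
Variable X : sdr_index n m.+1 -> {RV P >-> R}.
Variable sel : 'M[R]_(m.+1 + 1) -> 'M[R]_(m.+1 + 1).
Hypothesis sigma_gt0 : 0 < sigma.
Hypothesis indep : mutually_independent P (fun i => (X i : T -> R)).
Hypothesis lawH : forall i j, has_law P (X (inl (inl (i, j)))) (normal_prob 0 sigma).
Hypothesis laww : forall i, has_law P (X (inl (inr i))) (normal_prob 0 1).
Hypothesis laws : forall j, P (X (inr j) @^-1` [set 1]) = (1 / 2)%:E /\
  P (X (inr j) @^-1` [set -1]) = (1 / 2)%:E.
Hypothesis selP : forall L, sdr_optimal L (sel L).

(** The cell of [H] for which [H diag(s)] rounds to [g]: when [sg i] holds, that is [s_i = -1], the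
    interval is reflected. Noise and signs are left free. *)
Definition grid_cell (M : nat) (g : 'M[int]_(n, m.+1)) (sg : 'I_m.+1 -> bool)
    (k : sdr_index n m.+1) : set R :=
  match k with
  | inl (inl (a, i)) =>
      if sg i then `[- ((g a i)%:~R + 1) / M%:R ^+ J, - (g a i)%:~R / M%:R ^+ J]%classic
      else `[(g a i)%:~R / M%:R ^+ J, ((g a i)%:~R + 1) / M%:R ^+ J]%classic
  | _ => setT
  end.

Lemma measurable_grid_cell M g sg k : measurable (grid_cell M g sg k).
Proof. by case: k => [[[a i]|a]|j] //=; case: (sg i). Qed.

Lemma grid_cell_prob M g sg : (0 < M)%N ->
  (P [set w | forall k, grid_cell M g sg k (X k w)]
    <= ((normal_peak sigma / M%:R ^+ J) ^+ (n * m.+1))%:E)%E.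
Proof.
move=> M0; have N0 : 0 < M%:R ^+ J :> R by rewrite exprn_gt0 // ltr0n.
pose b (k : sdr_index n m.+1) : R :=
  if k is inl (inl _) then normal_peak sigma / M%:R ^+ J else 1.
apply: le_trans (_ : (_ <= (\prod_k b k)%:E)%E) _.
  apply: independent_box_le => // [k|k]; first exact: measurable_grid_cell.
  case: k => [[[a i]|a]|j] /=; last 2 first.
  - by rewrite preimage_setT probability_setT.
  - by rewrite preimage_setT probability_setT.
  rewrite lawH; last exact: (measurable_grid_cell M g sg (inl (inl (a, i)))).
  case: (sg i).
    apply: le_trans (normal_prob_itv _ _) _ => //.
      by rewrite ler_wpM2r ?invr_ge0 ?(ltW N0) // lerN2 lerDl.
    by rewrite lee_fin -mulrBl opprK addKr mul1r.
  apply: le_trans (normal_prob_itv _ _) _ => //.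
    by rewrite ler_wpM2r ?invr_ge0 ?(ltW N0) // lerDl.
  by rewrite lee_fin -mulrBl addrAC subrr add0r mul1r.
rewrite !big_sumType /= !big1_eq !mulr1 prodr_const.
by rewrite lee_fin card_prod !card_ord.
Qed.

Lemma sdr_error_subset (M : nat) (rho : R) (w : T) :
  (12 * m + 10 + 2 * n <= M)%N -> M%:R ^+ (2 * J) <= rho ->
  (forall j, X (inr j) w = 1 \/ X (inr j) w = -1) ->
  (forall k, `|X (inl k) w| <= M%:R) ->
  sdr_error_event (fun i => (X i : T -> R)) sel rho w ->
  degenerate M J (\matrix_(a, i) (X (inl (inl (a, i))) w * X (inr i) w)).
Proof.
move=> mM Mrho s1 HM err.
have M0 : 0 < M%:R :> R by rewrite ltr0n; lia.
have N0 : 0 < M%:R ^+ J :> R by rewrite exprn_gt0.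
set s := rv_s (fun i => (X i : T -> R)) w.
have -> : (\matrix_(a, i) (X (inl (inl (a, i))) w * X (inr i) w)) =
    \matrix_(a, i) (rv_H (fun i => (X i : T -> R)) w a i * s i 0).
  by apply/matrixP => a i; rewrite !mxE.
apply: (sdr_error_near_degenerate (v := rv_v (fun i => (X i : T -> R)) rho w) _ _
  (selP _) err).
- lia.
- by move=> i; rewrite mxE; exact: s1.
- by move=> a i; rewrite mxE.
have rho0 : 0 < rho by apply: lt_le_trans Mrho; rewrite exprn_gt0.
(* Each squared noise entry is at most [M ^ 2 / rho], and [2 n <= M] absorbs the remaining
   factor. *)
apply: le_trans (_ : 2 * \sum_(a < n) (M%:R ^+ 2 / rho) <= _).
  apply: ler_wpM2l => //; apply: ler_sum => a _.
  rewrite !mxE exprMn exprVn sqr_sqrtr ?(ltW rho0) // mulrC ler_pM2r ?invr_gt0 //.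
  by rewrite -[leLHS]real_normK ?num_real // ler_pXn2r ?nnegrE // ltW.
rewrite sumr_const card_ord -[_ *+ n]mulr_natl !mulrA expr_div_n.
apply: ler_pM; rewrite ?invr_ge0 ?(ltW rho0) ?mulr_ge0 ?exprn_ge0 ?(ltW M0) //.
  rewrite -(natrM _ 2) -!natrM -!natrX ler_nat -mulnA (_ : (M ^ 2) ^ 2 = M * M * (M * M))%N //.
  by rewrite leq_mul2r; apply/orP; right; nia.
by rewrite lef_pV2 ?posrE ?exprn_gt0 // -exprM mulnC.
Qed.

Hypothesis mnr : m.+1 = (n + r)%N.
Hypothesis r_small : ('C(r.+1, 2) <= n)%N.
Hypothesis merr : forall rho, 0 < rho ->
  measurable (sdr_error_event (fun i => (X i : T -> R)) sel rho).

(** Union bound over four kinds of events: some [s_j] is not a sign, an entry of [H] exceeds [M], an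
    entry of [w] does, or [H] lies in the cell of a degenerate integer matrix. The last kind
    contributes the count of these matrices and sign patterns times the probability of one cell. *)
Lemma sdr_error_prob_le : exists2 C : R, 0 <= C &
  forall (M : nat) (rho : R), (12 * m + 10 + 2 * n <= M)%N ->
    M%:R ^+ (2 * J) <= rho ->
    (P (sdr_error_event (fun i => (X i : T -> R)) sel rho)
      <= (C * M%:R ^+ (9 * m.+1 * (m.+1 + n))
            / M%:R ^+ (J * (n - 'C(r.+1, 2))))%:E)%E.
Proof.
set c0 := (9 * _ * _)%N; set q := (J * _)%N.
have [K K0 tail] := normal_prob_tail_pow q sigma_gt0.
have [K1 K10 tail1] := normal_prob_tail_pow q (ltr01 : 0 < 1 :> R).
have pk0 := normal_peak_ge0 sigma.
exists ((n * m.+1)%:R * K + n%:R * K1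
  + (2 ^ m.+1 * #|skeleton m J|)%:R * normal_peak sigma ^+ (n * m.+1)).
  by rewrite !addr_ge0 // mulr_ge0 // exprn_ge0.
move=> M rho mM Mrho; have M0 : (0 < M)%N by lia.
have MR0 : 0 < M%:R :> R by rewrite ltr0n.
have N0 : 0 < M%:R ^+ J :> R by rewrite exprn_gt0.
have rho0 : 0 < rho by apply: lt_le_trans Mrho; rewrite exprn_gt0.
(* Entries of modulus at most [M], scaled by [M ^ J], round to integers in [[-B, B]], encoded with
   the offset [B]. *)
pose B := (M ^ J.+1)%N.
pose G (f : 'M['I_(2 * B).+1]_(n, m.+1)) : 'M[int]_(n, m.+1) :=
  \matrix_(a, i) ((f a i : nat)%:Z - B%:Z).
have Ginj : injective G.
  move=> f g /matrixP fg; apply/matrixP => a i; apply: val_inj.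
  by have := fg a i; rewrite !mxE => /addIr [].
pose bad f := `[< exists h : 'M[R]_(n, m.+1),
  degenerate M J h /\ forall a i, G f a i = Num.floor (h a i * M%:R ^+ J) >].
have badK : (#|bad| <= #|skeleton m J|
    * M ^ (n * m * J + 'C(r.+1, 2) * J + c0))%N.
  rewrite -(cardsE bad).
  apply: (card_degenerate (R := R) (G := G) _ mnr) => //; first by lia.
  by move=> f; rewrite inE => /asboolP.
pose I : finType := ('I_m.+1 + 'I_n * 'I_m.+1 + 'I_n
  + {ffun 'I_m.+1 -> bool} * {f | bad f})%type.
pose big := [set x : R | M%:R < `|x|].
pose F (k : I) : set T := match k with
  | inl (inl (inl j)) => X (inr j) @^-1` (~` ([set 1] `|` [set -1]))
  | inl (inl (inr (a, i))) => X (inl (inl (a, i))) @^-1` big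
  | inl (inr a) => X (inl (inr a)) @^-1` big
  | inr (sg, f) => [set w | forall k, grid_cell M (G (val f)) sg k (X k w)]
  end.
pose b (k : I) : R := match k with
  | inl (inl (inl j)) => 0
  | inl (inl (inr _)) => K / M%:R ^+ q
  | inl (inr a) => K1 / M%:R ^+ q
  | inr _ => (normal_peak sigma / M%:R ^+ J) ^+ (n * m.+1)
  end.
have mbig : measurable big.
  rewrite [big](_ : _ = (fun x : R => `|x|) @^-1` `]M%:R, +oo[).
    by rewrite -[X in measurable X]setTI; exact: normr_measurable.
  by apply/seteqP; split => x /=; rewrite in_itv /= andbT.
have mX k A : measurable A -> measurable (X k @^-1` A).
  by move=> mA; rewrite -[X in measurable X]setTI; exact: measurable_funP.
apply: le_trans (_ : (_ <= (\sum_k b k)%:E)%E) _.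
  apply: (probability_cover (F := F)); first exact: merr.
  - case=> [[[j|[a i]]|a]|[sg f]]; try exact: mX.
      by apply: mX; apply: measurableC; exact: measurableU.
    by apply: measurable_forall_preimage => k; exact: measurable_grid_cell.
  - move=> w err.
    have [s1|/existsNP[j sj]] :=
        pselect (forall j, X (inr j) w = 1 \/ X (inr j) w = -1); last first.
      by exists (inl (inl (inl j))).
    have [HM|/existsNP[[[a i]|a] /negP]] :=
        pselect (forall k, `|X (inl k) w| <= M%:R); last 2 first.
    + by rewrite -ltNge => Hb; exists (inl (inl (inr (a, i)))).
    + by rewrite -ltNge => Hb; exists (inl (inr a)).
    have dgn := sdr_error_subset mM Mrho s1 HM err.
    set h := \matrix_(a, i) _ in dgn.
    pose fl a i := Num.floor (h a i * M%:R ^+ J).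
    have hN a i : `|h a i * M%:R ^+ J| <= B%:R.
      rewrite normrM (gtr0_norm N0) /B natrX exprS ler_wpM2r ?(ltW N0) //.
      by rewrite mxE normrM; case: (s1 i) => ->; rewrite ?normrN normr1 mulr1.
    have flB a i : 0 <= fl a i + B%:Z <= (2 * B)%:Z.
      have := hN a i; rewrite ler_norml => /andP[lo hi].
      have flo := floor_le (h a i * M%:R ^+ J).
      apply/andP; split.
        by rewrite -lerBlDr sub0r floor_ge_int rmorphN.
      by rewrite mul2n -addnn PoszD lerD2r -(ler_int R) (le_trans flo).
    pose f : 'M['I_(2 * B).+1]_(n, m.+1) :=
      \matrix_(a, i) inord (absz (fl a i + B%:Z)).
    have Gf a i : G f a i = fl a i.
      have := flB a i; rewrite !mxE => /andP[lo hi].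
      rewrite inordK ?gez0_abs ?addrK //.
      by rewrite ltnS -lez_nat gez0_abs.
    have fbad : bad f by apply/asboolP; exists h.
    exists (inr ([ffun i => X (inr i) w == -1], exist _ f fbad)).
    case=> [[[a i]|a]|j] //=; rewrite ffunE Gf.
    have := floor_cell (h a i) N0; rewrite -/(fl a i) [in X in X -> _]mxE.
    case: (s1 i) => -> /=.
      have -> : (1 == -1 :> R) = false by rewrite eq_sym lt_eqF // ltrN10 ltr01.
      by rewrite mulr1 /= in_itv.
    rewrite eqxx mulrN1 /= in_itv /= lerNr lerNl andbC.
    by rewrite !mulNr.
  - case=> [[[j|[a i]]|a]|[sg f]] /=.
    + by rewrite fair_sign_ae //; have [] := laws j.
    + by rewrite lawH //; exact: tail.
    + by rewrite laww //; exact: tail1.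
    + exact: grid_cell_prob.
move: #|skeleton m J| badK => S0 badK.
rewrite lee_fin !big_sumType /= big1_eq add0r.
rewrite !sumr_const !card_prod !card_ord card_ffun card_bool card_ord card_sig.
rewrite -[(K / _) *+ _]mulr_natl -[(K1 / _) *+ _]mulr_natl.
rewrite -[(_ ^+ _) *+ _]mulr_natl !mulrDl.
have Mc0 : 1 <= M%:R ^+ c0 :> R by rewrite exprn_ege1 // ler1n.
have Mq0 : 0 < M%:R ^+ q :> R by rewrite exprn_gt0.
have tail_le (k : nat) (L : R) : 0 <= L ->
    k%:R * (L / M%:R ^+ q) <= k%:R * L * M%:R ^+ c0 / M%:R ^+ q.
  move=> L0; rewrite mulrA ler_wpM2r ?invr_ge0 ?(ltW Mq0) //.
  by rewrite ler_peMr // mulr_ge0.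
rewrite lerD ?lerD ?tail_le //.
have Mexp : M%:R ^+ (n * m * J + 'C(r.+1, 2) * J + c0)
    = M%:R ^+ (J * (n * m.+1)) * M%:R ^+ c0 / M%:R ^+ q :> R.
  apply: (mulIf (lt0r_neq0 Mq0)); rewrite divfK ?lt0r_neq0 // -!exprD.
  by congr (_ ^+ _); exact: exponent_balance.
have bad_le : #|[pred x | bad x]|%:R
    <= S0%:R * (M%:R ^+ (J * (n * m.+1)) * M%:R ^+ c0 / M%:R ^+ q) :> R.
  by rewrite -Mexp -natrX -natrM ler_nat.
rewrite natrM expr_div_n -exprM mulrA ler_pdivrMr ?exprn_gt0 //.
have -> : (2 ^ m.+1 * S0)%:R * normal_peak sigma ^+ (n * m.+1) * M%:R ^+ c0
      / M%:R ^+ q * M%:R ^+ (J * (n * m.+1))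
    = (2 ^ m.+1)%:R * (S0%:R * (M%:R ^+ (J * (n * m.+1)) * M%:R ^+ c0 / M%:R ^+ q))
      * normal_peak sigma ^+ (n * m.+1).
  by rewrite natrM; ring.
by rewrite ler_wpM2r ?exprn_ge0 // ler_wpM2l.
Qed.

End ErrorProbability.

(** * Diversity order *)

Lemma nat_root_bounds (R : realType) (k : nat) (rho : R) : (0 < k)%N -> 1 <= rho ->
  exists2 M : nat, M%:R ^+ k <= rho & rho < M.+1%:R ^+ k.
Proof.
move=> k0 rho1; have rho0 : 0 <= rho by lra.
pose y := rho `^ (k%:R^-1); have y0 : 0 <= y by exact: powR_ge0.
have yk : y ^+ k = rho.
  by rewrite -powR_mulrn // -powRrM mulVf ?pnatr_eq0 ?lt0n_neq0 // powRr1.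
exists (Num.truncn y).
  by rewrite -yk lerXn2r ?nnegrE // truncn_le.
by rewrite -yk ltrXn2r ?lt0n_neq0 ?nnegrE // truncnS_gt.
Qed.

(** Let [M] be the integer part of the [2 J]-th root of [rho]. Then [ln M] is [ln rho / (2 J)] up to
    a constant, and the quotient is at most [c / (2 J) - D / 2] plus a vanishing term; [J] is chosen
    according to [e]. *)
Lemma limf_esup_eln_le (R : realType) (p : R -> \bar R) (D c : nat) :
  (forall rho : R, (0 < rho)%R -> (0 <= p rho)%E) ->
  (forall J, (0 < J)%N -> exists2 C : R, 0 <= C & exists M0 : nat,
     forall (M : nat) (rho : R), (M0 <= M)%N -> M%:R ^+ (2 * J) <= rho ->
       (p rho <= (C * M%:R ^+ c / M%:R ^+ (J * D))%:E)%E) ->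
  (limf_esup (fun rho : R => eln (p rho) * ((ln rho)^-1)%:E)%E (pinfty_nbhs R)
    <= (- (D%:R / 2))%:E)%E.
Proof.
move=> p0 pJ; apply/lee_addgt0Pr => e e0.
have [J J0 cJ] : exists2 J : nat, (0 < J)%N & c%:R / (2 * J%:R) <= e / 2.
  exists (Num.truncn (c%:R / e)).+1 => //.
  have := truncnS_gt (c%:R / e); move: (Num.truncn _).+1 (ltn0Sn (Num.truncn (c%:R / e))) => J J0.
  rewrite ltr_pdivrMr // ler_pdivrMr ?mulr_gt0 ?ltr0n // => h.
  by rewrite mulrCA; lra.
have JR0 : 0 < J%:R :> R by rewrite ltr0n.
have J2 : (0 < 2 * J)%N by rewrite muln_gt0.
have [C C0 [M0 bound]] := pJ J J0.
(* The [ln 2] comes from [M + 1 <= 2 M], and [C + 1] keeps the logarithm defined when [C = 0]. *)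
pose K : R := ln (C + 1) + (J * D)%:R * ln 2.
pose R0 : R := Num.max (Num.max 1 ((M0 + 2)%:R ^+ (2 * J))) (expR (2 * `|K| / e)).
apply: ge_ereal_inf => /=.
exists (ereal_sup [set (eln (p rho) * ((ln rho)^-1)%:E)%E | rho in [set rho | R0 < rho]]).
  exists [set rho | R0 < rho] => //.
  by exists R0; split; [exact: num_real|].
apply: ub_ereal_sup => _ [rho /= + <-]; rewrite !gt_max -!andbA => /and3P[rho1 rhoM rhoK].
have rho0 : 0 < rho by lra.
have x0 : 0 < ln rho by exact: ln_gt0.
have Kx : `|K| / ln rho <= e / 2.
  have : 2 * `|K| / e < ln rho by rewrite -ltr_expR lnK.
  rewrite ltr_pdivrMr // => h; rewrite ler_pdivrMr //.
  by rewrite mulrAC ler_pdivlMr //; lra.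
have [M Mlo Mhi] := nat_root_bounds J2 (ltW rho1).
have M02 : (M0 + 2 <= M)%N.
  have := lt_trans rhoM Mhi; by rewrite ltr_pXn2r ?nnegrE // ltr_nat ltnS.
have M1 : (0 < M)%N by apply: leq_trans M02; rewrite addn2.
have MR0 : 0 < M%:R :> R by rewrite ltr0n.
have lnM_le : (2 * J)%:R * ln M%:R <= ln rho.
  by rewrite mulr_natl -lnXn // ler_ln ?posrE ?exprn_gt0.
have lnM_ge : ln rho <= (2 * J)%:R * (ln 2 + ln M%:R).
  rewrite -lnM ?posrE // mulr_natl -lnXn ?mulr_gt0 //.
  rewrite ler_ln ?posrE ?exprn_gt0 ?mulr_gt0 //.
  apply: le_trans (ltW Mhi) _; rewrite lerXn2r ?nnegrE ?mulr_ge0 ?(ltW MR0) //.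
  by rewrite -natrM ler_nat mul2n -addnn -addn1 leq_add2l.
have := p0 rho rho0; have := bound M rho (leq_trans (leq_addr 2 M0) M02) Mlo.
case: (p rho) => [u| |] //; rewrite !lee_fin => u_le u_ge0.
rewrite /eln; case: ifPn => [_|u_neq0].
  (* For probability zero the logarithm is set to [-oo], and the quotient is [-oo] too. *)
  by rewrite gt0_mulNye ?lte_fin ?invr_gt0 // leNye.
have {u_ge0 u_neq0} u0 : 0 < u by rewrite lt_def u_ge0 andbT; move: u_neq0; rewrite eqe.
rewrite /= -EFinM -EFinD lee_fin.
have lnu : ln u <= ln (C + 1) + c%:R * ln M%:R - (J * D)%:R * ln M%:R.
  have C1 : 0 < C + 1 by lra.
  apply: (@le_trans _ _ (ln ((C + 1) * M%:R ^+ c / M%:R ^+ (J * D)))).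
    rewrite ler_ln ?posrE ?divr_gt0 ?mulr_gt0 ?exprn_gt0 //.
    apply: le_trans u_le _; rewrite ler_wpM2r ?invr_ge0 ?exprn_ge0 ?(ltW MR0) //.
    by rewrite ler_wpM2r ?exprn_ge0 ?(ltW MR0) //; lra.
  by rewrite ln_div ?lnM ?lnXn ?posrE ?mulr_gt0 ?exprn_gt0 // !mulr_natl.
have key : ln u <= `|K| + (c%:R / (2 * J%:R) - D%:R / 2) * ln rho.
  have B1 : ln M%:R <= ln rho / (2 * J%:R).
    by rewrite ler_pdivlMr ?mulr_gt0 // mulrC -(natrM R 2).
  have B2 : ln rho / (2 * J%:R) - ln 2 <= ln M%:R.
    by rewrite lerBlDr ler_pdivrMr ?mulr_gt0 // mulrC addrC -(natrM R 2).
  have B1c : c%:R * ln M%:R <= c%:R * (ln rho / (2 * J%:R)) by rewrite ler_wpM2l.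
  have B2D : (J * D)%:R * (ln rho / (2 * J%:R) - ln 2) <= (J * D)%:R * ln M%:R.
    by rewrite ler_wpM2l.
  have eqD : (J * D)%:R * (ln rho / (2 * J%:R)) = D%:R / 2 * ln rho.
    by rewrite natrM; field; rewrite lt0r_neq0.
  have KK := ler_norm K; rewrite {1}/K in KK.
  rewrite mulrBr eqD in B2D; rewrite mulrBl mulrAC -mulrA; lra.
rewrite ler_pdivrMr // mulrDl.
have cJx : c%:R / (2 * J%:R) * ln rho <= e / 2 * ln rho.
  by rewrite ler_wpM2r // ltW.
have Kx' : `|K| <= e / 2 * ln rho by rewrite -ler_pdivrMr.
rewrite mulrBl in key; lra.
Qed.

Lemma sdr_dE (R : realType) (n r : nat) :
  sdr_d R n (n + r) = (n%:R - ('C(r.+1, 2))%:R) / 2.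
Proof.
have binE : ('C(r.+1, 2))%:R * 2 = r%:R * (r%:R + 1) :> R.
  elim: r => [|r IHr]; first by rewrite mul0r mul0r.
  by rewrite binS bin1 natrD mulrDl IHr -!natr1; ring.
rewrite /sdr_d addKn natrD; have -> : ('C(r.+1, 2))%:R = r%:R * (r%:R + 1) / 2 :> R.
  by rewrite -binE mulfK.
by field.
Qed.

Theorem theorem2 (R : realType) (n m : nat)
    (d0 : measure_display) (T : measurableType d0) (P : probability T R)
    (sigma : R) (X : sdr_index n m -> {RV P >-> R})
    (sel : 'M[R]_(m + 1) -> 'M[R]_(m + 1)) :
  (n < m)%N ->
  0 < sigma ->
  mutually_independent P (fun i => (X i : T -> R)) ->
  (forall i j, has_law P (X (inl (inl (i, j)))) (normal_prob 0 sigma)) ->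
  (forall i, has_law P (X (inl (inr i))) (normal_prob 0 1)) ->
  (forall j, P (X (inr j) @^-1` [set 1]) = (1 / 2)%:E /\
             P (X (inr j) @^-1` [set -1]) = (1 / 2)%:E) ->
  (forall L, sdr_optimal L (sel L)) ->
  (forall rho, 0 < rho -> measurable (sdr_error_event (fun i => (X i : T -> R)) sel rho)) ->
  (limf_esup
     (fun rho : R => eln (P (sdr_error_event (fun i => (X i : T -> R)) sel rho))
                     * ((ln rho)^-1)%:E)%E
     (pinfty_nbhs R)
   <= (- sdr_d R n m)%:E)%E.
Proof.
case: m => // m in X sel *.
move=> nm s0 indep lawH laww laws selP merr.
have mnr : m.+1 = (n + (m.+1 - n))%N by rewrite subnKC // ltnW.
set r := (m.+1 - n)%N in mnr; rewrite [sdr_d R n m.+1](_ : _ = sdr_d R n (n + r)).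
  rewrite sdr_dE; have [kn|nk] := leqP 'C(r.+1, 2) n.
    rewrite -natrB //.
    apply: (limf_esup_eln_le (c := 9 * m.+1 * (m.+1 + n))) => [rho _|J J0].
      exact: measure_ge0.
    have [C C0 bound] := sdr_error_prob_le J s0 indep lawH laww laws selP mnr kn merr.
    by exists C => //; exists (12 * m + 10 + 2 * n)%N.
  (* Here [d < 0], and the trivial bound of the probability by 1 gives a limit superior at most
     0. *)
  apply: (@le_trans _ _ (- (0%:R / 2))%:E); last first.
    by rewrite lee_fin lerN2 ler_pM2r ?invr_gt0 // lerBlDr -natrD ler_nat ltnW.
  apply: (limf_esup_eln_le (c := 0)) => [rho _|J J0]; first exact: measure_ge0.
  exists 1 => //; exists 1%N => M rho M0 Mrho.
  rewrite muln0 !expr0 mulr1 divr1; apply: probability_le1; apply: merr.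
  by apply: lt_le_trans Mrho; rewrite exprn_gt0 // ltr0n.
by rewrite -mnr.
Qed.
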